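(* (i) Let $G$ be an $n$-vertex graph with diversity $D\ge 2$ and maximum clique size $S$. For any positive integer $x$ with $x=o(\log S)$, there is a deterministic distributed algorithm in the LOCAL model that computes a proper vertex coloring of $G$ with $D^{x+1}S$ colors within $\tilde O\big(x\cdot\sqrt{D\,S^{1/(x+1)}}\big)+O(\log^* n)$ rounds. (ii) Let $G$ be an $n$-vertex graph of maximum degree $\Delta$. For any positive integer $x$ with $x=o(\log\Delta)$, there is a deterministic distributed algorithm in the LOCAL model that computes a proper edge coloring of $G$ with $2^{x+1}\Delta$ colors within $\tilde O\big(x\cdot\Delta^{1/(2x+2)}\big)+O(\log^* n)$ rounds.
   Context: LOCAL model: the input graph is the communication network; each vertex is a processor with a unique ID of $O(\log n)$ bits and unbounded local computation; computation proceeds in synchronous rounds, in each of which every vertex may send a message of arbitrary size to each neighbor; running time is the number of rounds until all vertices terminate. Global parameters are assumed known to all vertices. In edge coloring, adjacent edges (sharing an endpoint) receive distinct colors and both endpoints of an edge must learn its color. The diversity of a vertex is the number of maximal cliques containing it; $D(G)$ is the maximum over all vertices. $\tilde O(f)$ hides factors polylogarithmic in the maximum degree of $G$. *)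

(* Defs.v *)
From Stdlib Require Import Reals.
From mathcomp Require Import all_boot.

Set Implicit Arguments.
Unset Strict Implicit.
Unset Printing Implicit Defensive.

Record instance := Instance {
  ivert : finType;
  iadj  : rel ivert;
  iid   : ivert -> nat }.
Arguments iadj : clear implicits.

Definition valid (I : instance) : Prop :=
  symmetric (iadj I) /\ irreflexive (iadj I) /\ injective (@iid I).

(* IDs of O(log n) bits: all IDs are < n^c *)
Definition ids_bounded (c : nat) (I : instance) : Prop :=
  forall v : ivert I, iid v < #|ivert I| ^ c.

Definition ball (I : instance) (v : ivert I) (r : nat) : {set ivert I} :=
  iter r (fun B => B :|: [set w | [exists u in B, iadj I u w]]) [set v].

Definition algorithm (O : Type) := forall I : instance, ivert I -> O.

(* The algorithm runs in (at most) r rounds of the LOCAL model: the output of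
   each vertex is a function of its ID-labelled radius-r view, i.e. it is
   invariant under ID-preserving isomorphisms of radius-r balls. *)
Definition local_alg (O : Type) (A : algorithm O) (r : nat) : Prop :=
  forall (I1 I2 : instance) (v1 : ivert I1) (v2 : ivert I2)
         (f : ivert I1 -> ivert I2),
    valid I1 -> valid I2 -> f v1 = v2 ->
    (forall u, u \in ball v1 r -> f u \in ball v2 r) ->
    (forall w, w \in ball v2 r -> exists2 u, u \in ball v1 r & f u = w) ->
    {in ball v1 r &, forall u w, iadj I2 (f u) (f w) = iadj I1 u w} ->
    {in ball v1 r, forall u, iid (f u) = iid u} ->
    A I1 v1 = A I2 v2.

Definition clique (I : instance) (K : {set ivert I}) : bool :=
  [forall u in K, forall w in K, (u != w) ==> iadj I u w].

Definition maximal_clique (I : instance) (K : {set ivert I}) : bool :=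
  clique K && [forall K' : {set ivert I}, (clique K' && (K \subset K')) ==> (K' == K)].

Definition diversity (I : instance) (v : ivert I) : nat :=
  #|[set K : {set ivert I} | maximal_clique K & v \in K]|.

Definition max_diversity (I : instance) : nat := \max_(v : ivert I) diversity v.

Definition max_clique_size (I : instance) : nat :=
  \max_(K : {set ivert I} | clique K) #|K|.

Definition max_degree (I : instance) : nat :=
  \max_(v : ivert I) #|[set w | iadj I v w]|.

Definition proper_vertex_coloring (I : instance) (col : ivert I -> nat) (k : nat) : Prop :=
  (forall v, col v < k) /\ (forall u w, iadj I u w -> col u <> col w).

(* edge coloring: vertex v outputs col v : nat -> nat, mapping the ID of a
   neighbour w to the colour of edge {v,w}; both endpoints must agree. *)
Definition proper_edge_coloring (I : instance) (col : ivert I -> nat -> nat) (k : nat) : Prop :=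
  (forall u w, iadj I u w -> col u (iid w) = col w (iid u) /\ col u (iid w) < k) /\
  (forall v u w, iadj I v u -> iadj I v w -> u <> w -> col v (iid u) <> col v (iid w)).

Fixpoint logstar_aux (fuel m : nat) : nat :=
  match fuel with
  | 0 => 0
  | fuel'.+1 => if m <= 1 then 0 else (logstar_aux fuel' (Nat.log2 m)).+1
  end.
Definition logstar (m : nat) : nat := logstar_aux m m.

Definition little_o_log (xf : nat -> nat) : Prop :=
  forall eps : R, Rlt 0 eps ->
    exists N : nat, forall m : nat, N <= m -> Rle (INR (xf m)) (Rmult eps (ln (INR m))).

Local Open Scope R_scope.

(* polylog(Delta) factor hidden by O~ *)
Definition polylog (k Delta : nat) : R := (ln (INR Delta + 1) + 1) ^ k.

Definition vertex_round_bound (C k x n Delta D S : nat) : R :=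
  INR C * (INR x * sqrt (INR D * Rpower (INR S) (1 / (INR x + 1))) * polylog k Delta
           + INR (logstar n)) + INR C.

Definition edge_round_bound (C k x n Delta : nat) : R :=
  INR C * (INR x * Rpower (INR Delta) (1 / (2 * INR x + 2)) * polylog k Delta
           + INR (logstar n)) + INR C.

(* Main.v *)
(* The edges are covered by "clubs" (the maximal cliques of the graph, or the stars
   of the graph when its line graph is coloured): every vertex lies in at most [D]
   clubs, of size at most [S].  Splitting every club into groups of [t] vertices and colouring
   the graph of pairs inside a group takes at most [D(t-1)+1] colours, and inside a
   colour class the clubs have size at most [ceil(S/t)].  With [t] about
   [S^(1/(x+1))], after [x+1] such steps the product of the palettes is at most
   [D^(x+1) S]; when [S < 2t^2] remains, one step with [t = floor(sqrt S)] absorbs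
   the rounding.

   Each step is a [(d+1)]-colouring of a graph of maximum degree [d] in about
   [sqrt d] rounds, starting from the poly([Delta])-colouring of Linial.  Colours
   are turned into polynomials over a finite field that differ from each other by
   non-constants, so that they agree in few points even after a translation.  In
   one phase the uncoloured vertices get an arbdefective colouring with about
   [sqrt d] classes, and the classes are processed one after the other: the palette
   is a set of points of the plane [L * L] with [#|L|] about [sqrt d], a vertex
   picks a translate of the graph of its polynomial with many free points, and then
   a free point that avoids the translates of its few rivals.  Vertices with too
   few free colours skip the phase, and their uncoloured degree is halved. *)
Require Import Defs.
From Stdlib Require Import Reals Lra.
From mathcomp Require Import all_boot.
From mathcomp Require Import all_algebra finfield boolp zify.

Set Implicit Arguments.
Unset Strict Implicit.
Unset Printing Implicit Defensive.

(** * Views and locality *)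

Lemma in_ball0 (I : instance) (v w : ivert I) : (w \in ball v 0) = (w == v).
Proof. by rewrite /ball /= in_set1. Qed.

Lemma in_ballS (I : instance) (v w : ivert I) r :
  (w \in ball v r.+1) =
  (w \in ball v r) || [exists u in ball v r, iadj I u w].
Proof. by rewrite /ball /= !inE. Qed.

Lemma ball_center (I : instance) (v : ivert I) r : v \in ball v r.
Proof.
by elim: r => [|r IH]; rewrite ?in_ball0 ?eqxx // in_ballS IH.
Qed.

Lemma ball_step (I : instance) (v u w : ivert I) r :
  u \in ball v r -> iadj I u w -> w \in ball v r.+1.
Proof.
move=> uv uw; rewrite in_ballS; apply/orP; right.
by apply/existsP; exists u; rewrite uv.
Qed.

Lemma ball_trans (I : instance) (v u w : ivert I) r s :
  u \in ball v r -> w \in ball u s -> w \in ball v (r + s).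
Proof.
move=> uv; elim: s w => [|s IH] w.
  by rewrite in_ball0 addn0 => /eqP->.
rewrite in_ballS addnS => /orP[/IH wv|/existsP[x /andP[/IH xv xw]]].
  by rewrite in_ballS wv.
exact: ball_step xv xw.
Qed.

Lemma ball_mono (I : instance) (v w : ivert I) r s :
  r <= s -> w \in ball v r -> w \in ball v s.
Proof.
by move=> /subnK <- wv; rewrite addnC; apply: ball_trans wv (ball_center _ _).
Qed.

Lemma ball_adj (I : instance) (v w : ivert I) : iadj I v w -> w \in ball v 1.
Proof. exact: ball_step (ball_center v 0). Qed.

Definition view_iso (I1 I2 : instance) (f : ivert I1 -> ivert I2)
    (v : ivert I1) (r : nat) : Prop :=
  [/\ forall u, u \in ball v r -> f u \in ball (f v) r,
      forall w, w \in ball (f v) r -> exists2 u, u \in ball v r & f u = w,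
      {in ball v r &, forall u w, iadj I2 (f u) (f w) = iadj I1 u w} &
      {in ball v r, forall u, iid (f u) = iid u}].

Lemma local_algP (O : Type) (A : algorithm O) r :
  (forall I1 I2 (f : ivert I1 -> ivert I2) v, valid I1 -> valid I2 ->
     view_iso f v r -> A I1 v = A I2 (f v)) <-> local_alg A r.
Proof.
split=> [H I1 I2 v1 v2 f V1 V2 <- h1 h2 h3 h4|H I1 I2 f v V1 V2 [h1 h2 h3 h4]].
  exact: H.
exact: H.
Qed.

(** Both ball conditions follow by induction on the distance from [v]: edges map forward inside the
    ball, and edges leaving the image of a smaller ball lift back. *)
Lemma view_isoI (I1 I2 : instance) (f : ivert I1 -> ivert I2) v r :
  (forall u w, u \in ball v r -> iadj I1 u w -> w \in ball v r ->
     iadj I2 (f u) (f w)) ->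
  (forall s u w, s < r -> u \in ball v s -> iadj I2 (f u) w ->
     exists2 u', iadj I1 u u' & f u' = w) ->
  {in ball v r &, forall u w, iadj I2 (f u) (f w) = iadj I1 u w} ->
  {in ball v r, forall u, iid (f u) = iid u} -> view_iso f v r.
Proof.
move=> fwd lift adj ids; split=> //.
  suff H s u : s <= r -> u \in ball v s -> f u \in ball (f v) s by move=> u; apply: H.
  elim: s u => [|s IH] u ler; first by rewrite !in_ball0 => /eqP->.
  rewrite in_ballS => /orP[/(IH _ (ltnW ler)) us|/existsP[x /andP[xs xu]]].
    by rewrite in_ballS us.
  apply: (ball_step (IH _ (ltnW ler) xs)); apply: (fwd x u _ xu).
    by apply: ball_mono xs; exact: ltnW.
  by apply: ball_mono (ball_step xs xu).
suff H s w : s <= r -> w \in ball (f v) s -> exists2 u, u \in ball v s & f u = w.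
  by move=> w; apply: H.
elim: s w => [|s IH] w ler.
  by rewrite in_ball0 => /eqP->; exists v => //; rewrite in_ball0.
rewrite in_ballS => /orP[/(IH _ (ltnW ler))[u us <-]|/existsP[x /andP[]]].
  by exists u => //; rewrite in_ballS us.
move=> /(IH _ (ltnW ler))[u us <-] uw.
have [u' uu' <-] := lift s u w ler us uw.
by exists u' => //; apply: ball_step us uu'.
Qed.

(** Restriction to a nearby centre is what lets algorithms be composed. An edge lifts because its
    end is within distance [R] of [f v] and so has a preimage in the larger view. *)
Lemma view_iso_sub (I1 I2 : instance) (f : ivert I1 -> ivert I2) v u s r R :
  view_iso f v R -> u \in ball v s -> s + r <= R -> view_iso f u r.
Proof.
move=> [h1 h2 h3 h4] us srR.
have sub w : w \in ball u r -> w \in ball v R.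
  by move=> wu; apply: ball_mono srR _; apply: ball_trans us wu.
have fus t x : t <= R -> x \in ball v t -> f x \in ball (f v) t.
  elim: t x => [|t IH] x tR; first by rewrite !in_ball0 => /eqP->.
  rewrite in_ballS => /orP[/(IH _ (ltnW tR)) H|/existsP[y /andP[yt yx]]].
    by rewrite in_ballS H.
  apply: (ball_step (IH _ (ltnW tR) yt)).
  rewrite h3 //; first by apply: ball_mono yt; apply: ltnW.
  exact: ball_mono (ball_step yt yx).
apply: view_isoI.
- by move=> x y xu xy yu; rewrite h3 // sub.
- move=> t x w tr xu xw.
  have xR : x \in ball v (s + t) by apply: ball_trans us xu.
  have stR : s + t < R by apply: leq_trans srR; rewrite ltn_add2l.
  have wR : w \in ball (f v) R.
    by apply: (ball_mono stR); apply: ball_step xw; apply: (fus _ _ (ltnW stR)).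
  have [y yR yw] := h2 _ wR; exists y => //.
  by rewrite -h3 ?yw //; apply: ball_mono xR; apply: ltnW.
- by move=> x y xu yu; rewrite h3 // sub.
- by move=> x xu; rewrite h4 // sub.
Qed.

Lemma view_iso_le (I1 I2 : instance) (f : ivert I1 -> ivert I2) v r R :
  r <= R -> view_iso f v R -> view_iso f v r.
Proof. by move=> rR h; apply: view_iso_sub h (ball_center v 0) _. Qed.

Lemma view_iso_inj (I1 I2 : instance) (f : ivert I1 -> ivert I2) v r :
  valid I1 -> view_iso f v r -> {in ball v r &, injective f}.
Proof.
by move=> [_ [_ inj]] [_ _ _ h] x y xb yb fxy; apply: inj; rewrite -h // -(h y) // fxy.
Qed.

(** * Composing local algorithms *)

Lemma local_alg_mono (O : Type) (A : algorithm O) r s :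
  r <= s -> local_alg A r -> local_alg A s.
Proof.
move=> rs /local_algP h; apply/local_algP => I1 I2 f v V1 V2 /(view_iso_le rs).
exact: h.
Qed.

Lemma local_alg_map (X Y : Type) (g : X -> Y) (F : algorithm X) r :
  local_alg F r -> local_alg (fun I v => g (F I v)) r.
Proof.
by move=> /local_algP h; apply/local_algP => I1 I2 f v *; congr g; apply: h.
Qed.

Lemma local_alg_pair (X Y : Type) (F : algorithm X) (G : algorithm Y) r :
  local_alg F r -> local_alg G r -> local_alg (fun I v => (F I v, G I v)) r.
Proof.
move=> /local_algP h /local_algP h'; apply/local_algP => I1 I2 f v *.
by congr pair; [apply: h|apply: h'].
Qed.

Lemma local_alg_iid : local_alg (fun I v => iid v) 0.
Proof. by apply/local_algP => I1 I2 f v _ _ [_ _ _ h]; rewrite h ?ball_center. Qed.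

Lemma local_alg_const (X : Type) (x : X) : local_alg (fun I v => x) 0.
Proof. by []. Qed.

(** The multiset of neighbouring states, encoded by its counting function; it names no vertices and
    is therefore comparable across instances. *)
Definition nbr_count (X : Type) (F : algorithm X) : algorithm ((X -> bool) -> nat) :=
  fun I v P => #|[set u | iadj I v u && P (F I u)]|.

Lemma local_alg_count (X : Type) (F : algorithm X) r :
  local_alg F r -> local_alg (nbr_count F) r.+1.
Proof.
move=> /local_algP h; apply/local_algP => I1 I2 f v V1 V2 iso.
apply/funext => P; rewrite /nbr_count.
have Fu u : iadj I1 v u -> F I1 u = F I2 (f u).
  by move=> vu; apply: h => //; apply: (view_iso_sub iso (ball_adj vu)).
have iso1 := view_iso_le (ltn0Sn r) iso.
have inj := view_iso_inj V1 iso1.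
have [_ h2 h3 _] := iso1.
have -> : [set u | iadj I2 (f v) u && P (F I2 u)] =
          f @: [set u | iadj I1 v u && P (F I1 u)].
  apply/setP => w; apply/idP/imsetP => [|[u]]; rewrite !inE.
    move=> /andP[vw Pw]; have [u ub uw] := h2 _ (ball_adj vw).
    have vu : iadj I1 v u by rewrite -h3 ?uw ?ball_center.
    by exists u; rewrite ?inE ?vu ?Fu ?uw.
  move=> /andP[vu Pu] ->; rewrite -Fu // Pu h3 ?vu ?ball_center //.
  exact: ball_adj.
rewrite card_in_imset // => x y; rewrite !inE => /andP[vx _] /andP[vy _].
by apply: inj; apply: ball_adj.
Qed.

Lemma local_alg_step (X Y : Type) (Phi : X -> ((X -> bool) -> nat) -> Y)
    (F : algorithm X) r :
  local_alg F r -> local_alg (fun I v => Phi (F I v) (nbr_count F v)) r.+1.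
Proof.
move=> hF; apply: (@local_alg_map _ _ (fun p => Phi p.1 p.2)
  (fun I v => (F I v, nbr_count F v))).
apply: local_alg_pair; first exact: local_alg_mono hF.
exact: local_alg_count.
Qed.

(** * Polynomials attached to colours *)

Section PolynomialFamily.
Import GRing.Theory.
Local Open Scope ring_scope.
Variables (K : finFieldType) (k : nat).

(* No constant term, so that distinct colours give polynomials that are not
   translates of each other; the zero row is skipped, so that no polynomial
   is constant. *)
Definition color_row (a : nat) : 'rV[K]_k := nth 0 (rem 0 (enum 'rV[K]_k)) a.

Definition color_fun (a : nat) (t : K) : K := (rVpoly (color_row a) * 'X).[t].

(** The difference [p] has degree at most [k] and is nonzero: evaluation at [0] forces [c = 0], and
    cancelling ['X] then forces [v = w]. *)
Lemma card_row_agree (v w : 'rV[K]_k) (c : K) : v != w ->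
  (#|[set t : K | (rVpoly v * 'X).[t] == ((rVpoly w * 'X).[t] + c)%R]| <= k)%N.
Proof.
move=> vw; pose p := (rVpoly v - rVpoly w) * 'X - c%:P.
have p0 : p != 0.
  apply: contra vw; rewrite subr_eq0 => /eqP E.
  have c0 : c = 0 by have := congr1 (fun p => p.[0]) E; rewrite hornerMX mulr0 hornerC => <-.
  move: E; rewrite c0 => /eqP; rewrite mulf_eq0 polyX_eq0 orbF subr_eq0 => /eqP E.
  by apply/eqP; rewrite -(rVpolyK v) -(rVpolyK w) E.
have sp : (size p <= k.+1)%N.
  apply: leq_trans (size_polyD _ _) _; rewrite size_polyN geq_max.
  rewrite (leq_trans (size_polyC_leq1 _)) // andbT.
  apply: leq_trans (size_polyMleq _ _) _; rewrite size_polyX addn2 /= ltnS.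
  apply: leq_trans (size_polyD _ _) _; rewrite size_polyN geq_max.
  by rewrite !size_poly.
rewrite cardE -ltnS; apply: leq_trans sp; apply: max_poly_roots => //.
  apply/allP => t; rewrite mem_enum inE => /eqP E.
  rewrite /root /p mulrBl !(hornerD, hornerN) E hornerC.
  by rewrite [_ + c]addrC addrK subrr.
exact: enum_uniq.
Qed.

(** The strict bound on [m] makes room for the zero row, which is removed from the enumeration. *)
Lemma color_row_inj m : (m < #|K| ^ k)%N ->
  forall a b, (a < m)%N -> (b < m)%N -> a != b -> color_row a != color_row b.
Proof.
move=> mK a b am bm ab.
have sz : size (rem 0 (enum 'rV[K]_k)) = (#|K| ^ k).-1.
  by rewrite size_rem ?mem_enum // -cardE card_mx mul1n.
have lt i : (i < m)%N -> (i < size (rem 0%R (enum 'rV[K]_k)))%N.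
  by move=> im; rewrite sz; case: (#|K| ^ k)%N mK => // n mn; apply: leq_trans im _.
by rewrite /color_row nth_uniq ?lt // rem_uniq ?enum_uniq.
Qed.

Lemma color_row_neq0 m : (m < #|K| ^ k)%N ->
  forall a, (a < m)%N -> color_row a != 0.
Proof.
move=> mK a am.
have sz : size (rem 0 (enum 'rV[K]_k)) = (#|K| ^ k).-1.
  by rewrite size_rem ?mem_enum // -cardE card_mx mul1n.
have lt : (a < size (rem 0%R (enum 'rV[K]_k)))%N.
  by rewrite sz; case: (#|K| ^ k)%N mK => // n mn; apply: leq_trans am _.
have := mem_nth 0 lt; rewrite -/(color_row a) => H.
apply/eqP => E; move: H; rewrite E mem_rem_uniq ?enum_uniq //.
by rewrite inE eqxx.
Qed.

Lemma color_fun_agree m : (m < #|K| ^ k)%N ->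
  forall a b c, (a < m)%N -> (b < m)%N -> a != b ->
  (#|[set t | color_fun a t == (color_fun b t + c)%R]| <= k)%N.
Proof. by move=> mK a b c am bm ab; apply: card_row_agree; apply: color_row_inj mK _ _ _ _ _. Qed.

Lemma color_fun_const m : (m < #|K| ^ k)%N ->
  forall a c, (a < m)%N -> (#|[set t | color_fun a t == c]| <= k)%N.
Proof.
move=> mK a c am; have /(card_row_agree c) := color_row_neq0 mK am.
by under eq_finset => t do rewrite linear0 mul0r horner0 add0r.
Qed.

End PolynomialFamily.

(** * Linial's step and arbdefective colourings *)

Lemma card_exists_le (T U : finType) (A : {set U}) (B : U -> {set T}) k :
  (forall u, u \in A -> #|B u| <= k) ->
  #|[set t | [exists u in A, t \in B u]]| <= #|A| * k.
Proof.
move=> h; have -> : [set t | [exists u in A, t \in B u]] = \bigcup_(u in A) B u.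
  apply/setP => t; rewrite inE; apply/existsP/bigcupP => [[u /andP[]]|[u]].
    by exists u.
  by move=> uA tB; exists u; rewrite uA.
rewrite -sum_nat_const; apply: leq_trans (leq_sum _ h).
elim/big_rec2: _ => [|u n S _ IH]; first by rewrite cards0.
by rewrite cardsU; apply: leq_trans (leq_subr _ _) _; rewrite leq_add2l.
Qed.

Lemma exists_good_point (T U : finType) (G : {set T}) (A : {set U})
    (B : U -> {set T}) k :
  (forall u, u \in A -> #|B u| <= k) -> #|A| * k < #|G| ->
  exists2 t, t \in G & forall u, u \in A -> t \notin B u.
Proof.
move=> h lt; set bad := [set t | [exists u in A, t \in B u]].
have : ~~ (G \subset bad).
  apply: contraL lt => /subset_leq_card le; rewrite -leqNgt.
  exact: leq_trans le (card_exists_le h).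
case/subsetPn => t tG; rewrite inE negb_exists => /forallP tb; exists t => // u uA.
by have := tb u; rewrite uA.
Qed.

Section LinialStep.
Variables (Delta m k : nat) (K : finFieldType).
Hypotheses (mK : m < #|K| ^ k) (kK : k * Delta < #|K|).

Definition linial_choice (a : nat) (cnt : (nat -> bool) -> nat) : nat :=
  let t := odflt 0%R
    [pick t : K | cnt (fun b => color_fun k a t == color_fun k b t) == 0] in
  enum_rank (t, color_fun k a t).

(** Each of at most [Delta] neighbours spoils at most [k] field points, so a good [t] exists. Equal
    new colours would mean the same [t] with the same value, against the choice of [t]. *)
Lemma linial_step (F : algorithm nat) r : local_alg F r ->
  exists2 F' : algorithm nat, local_alg F' r.+1 &
  forall I : instance, (forall v u, iadj I v u -> F I v <> F I u) ->
    (forall v, F I v < m) -> (forall v, #|[set u | iadj I v u]| <= Delta) ->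
    (forall v u, iadj I v u -> F' I v <> F' I u) /\
    (forall v, F' I v < #|K| ^ 2).
Proof.
move=> locF; exists (fun I v => linial_choice (F I v) (nbr_count F v)).
  exact: local_alg_step.
move=> I prop Fm deg; split; last first.
  move=> v; rewrite /linial_choice; apply: leq_trans (ltn_ord _) _.
  by rewrite card_prod.
move=> v u vu /ord_inj/enum_rank_inj.
case: pickP => [t /eqP /=|no]; last first.
  case: (@exists_good_point _ _ [set: K] [set u | iadj I v u]
    (fun u => [set t | color_fun k (F I v) t == (color_fun k (F I u) t + 0)%R]) k).
  - move=> w; rewrite inE => vw; apply: (color_fun_agree mK) => //.
    by apply/eqP; apply: prop.
  - by rewrite cardsT mulnC; apply: leq_ltn_trans kK; rewrite leq_mul2l deg orbT.
  move=> t _ ht; move: (no t) => /negbT/negP[].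
  rewrite /nbr_count cards_eq0; apply/eqP/setP => w; rewrite !inE.
  apply/negP => /andP[vw] /eqP E; have := ht w; rewrite !inE GRing.addr0 E eqxx.
  by move/(_ vw).
move=> cnt0 [<- E].
move: cnt0 => /eqP; rewrite /nbr_count cards_eq0 => /eqP/setP/(_ u).
by rewrite !inE vu E eqxx.
Qed.
End LinialStep.

(** The subgraphs to be coloured are cut out by a relation on states, so that a round on the network
    simulates a round on the subgraph. *)
Definition adjR (X : Type) (F : algorithm X) (Rel : X -> X -> bool) (I : instance) :
  rel (ivert I) := fun v u => iadj I v u && Rel (F I v) (F I u).

Section Arbdefective.
Variables (m k delta : nat) (K : finFieldType).
Hypothesis mK : m < #|K| ^ k.

Definition field_pt (i : nat) : K := nth 0%R (enum K) i.

(** A decided neighbour is judged by its fixed value, an undecided one by the value that it would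
    try at the same moment. *)
Definition conflict (c t : K) (b : nat) (s : option (K * nat)) : bool :=
  if s is Some p then p.1 == c else color_fun k b t == c.

Definition arb_step (i : nat) (x : nat * option (K * nat))
    (cnt : (nat * option (K * nat) -> bool) -> nat) : option (K * nat) :=
  if x.2 is Some p then Some p else
  let c := color_fun k x.1 (field_pt i) in
  if cnt (fun y => conflict c (field_pt i) y.1 y.2) <= delta
  then Some (c, i) else None.

Section Graph.
Variables (V : finType) (e : rel V) (psi : V -> nat) (d : nat).

Fixpoint arb (i : nat) (v : V) : option (K * nat) :=
  if i is j.+1 then
    arb_step j (psi v, arb j v) (fun P => #|[set u | e v u && P (psi u, arb j u)]|)
  else None.

Lemma arb_mono i j v p : i <= j -> arb i v = Some p -> arb j v = Some p.
Proof.
move=> /subnK <-; elim: (j - i) => [//|l IH] /IH E.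
by rewrite addSn /= /arb_step /= E.
Qed.

Lemma arbP i v p : arb i v = Some p ->
  [/\ p.2 < i, arb p.2.+1 v = Some p,
      p.1 = color_fun k (psi v) (field_pt p.2) &
   #|[set u | e v u && conflict p.1 (field_pt p.2) (psi u) (arb p.2 u)]| <= delta].
Proof.
elim: i => [//|i IH] /=; case E: (arb i v) => [q|].
  by move=> [Ep]; move: E; rewrite Ep => /IH[? ? ? ?]; split => //; apply: ltnW.
rewrite {1}/arb_step /=; case: ifP => // le [<-]; split => //.
by rewrite /= E /arb_step /= le.
Qed.

Hypotheses (psim : forall v, psi v < m)
  (psiP : forall v u, e v u -> psi v <> psi u)
  (deg : forall v, #|[set u | e v u]| <= d)
  (big : 2 * k * d < #|K| * delta.+1).

Lemma sum_field_pt (P : pred K) :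
  \sum_(i < #|K|) P (field_pt i) = #|[set t | P t]|.
Proof.
rewrite -sum1dep_card [RHS]big_mkcond /=.
transitivity (\sum_(t <- enum K) (if P t then 1 else 0)); last first.
  by rewrite big_enum.
rewrite (big_nth 0%R) big_mkord -cardE; apply: eq_bigr => i _.
by rewrite /field_pt; case: (P _).
Qed.

(* An undecided vertex sees more than [delta] conflicts at each of the [#|K|]
   times, but each neighbour can cause at most [k] conflicts before it has
   decided and at most [k] conflicts afterwards. *)
Lemma arb_decides v : arb #|K| v != None.
Proof.
apply/eqP => und.
have und_i i : i <= #|K| -> arb i v = None.
  move=> le; case E: (arb i v) => [p|//].
  by move: und; rewrite (arb_mono le E).
pose conf (i : nat) u :=
  conflict (color_fun k (psi v) (field_pt i)) (field_pt i) (psi u) (arb i u).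
have many (i : 'I_#|K|) : delta.+1 <= \sum_(u in [set u | e v u]) conf i u.
  have := und_i i.+1 (ltn_ord i); rewrite /= /arb_step /= (und_i i (ltnW (ltn_ord i))).
  case: ifP => // /negbT; rewrite -ltnNge => lt _; apply: leq_trans lt _.
  rewrite -[leqLHS]sum1_card [leqLHS]big_mkcond [leqRHS]big_mkcond /=.
  by apply: leq_sum => u _; rewrite !inE /conf; case: (e v u) => //=; case: conflict.
have few u : e v u -> \sum_(i < #|K|) conf i u <= 2 * k.
  move=> vu.
  pose A (t : K) := color_fun k (psi u) t == (color_fun k (psi v) t + 0)%R.
  pose B (t : K) := if arb #|K| u is Some p then color_fun k (psi v) t == p.1 else false.
  have le (i : 'I_#|K|) : conf i u <= A (field_pt i) + B (field_pt i).
    rewrite /conf /conflict; case E: (arb i u) => [p|].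
      have le : i <= #|K| by apply: ltnW.
      by rewrite /B (arb_mono le E) eq_sym leq_addl.
    by rewrite /A GRing.addr0 leq_addr.
  apply: leq_trans (leq_sum _ (fun i _ => le i)) _.
  rewrite big_split /= !sum_field_pt mulSn mul1n leq_add //.
    apply: (color_fun_agree mK) => //.
    by apply/eqP => E; apply: (psiP vu).
  rewrite /B; case: (arb #|K| u) => [p|]; first exact: (color_fun_const mK).
  by rewrite (_ : [set t | false] = set0) ?cards0 //; apply/setP => t; rewrite !inE.
have : #|K| * delta.+1 <= 2 * k * d.
  rewrite -[X in X * _](card_ord #|K|) -sum_nat_const.
  apply: leq_trans (leq_sum _ (fun i _ => many i)) _.
  rewrite exchange_big /=.
  have le2 u : u \in [set u | e v u] -> \sum_(i < #|K|) conf i u <= 2 * k.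
    by rewrite inE; apply: few.
  apply: leq_trans (leq_sum _ le2) _.
  by rewrite sum_nat_const mulnC leq_mul2l deg orbT.
by rewrite leqNgt big.
Qed.

Definition arb_out v : K * nat := odflt (0%R, 0) (arb #|K| v).

(** A neighbour in the class of [v] that decided no later was already a conflict when [v] decided:
    through its fixed value if it decided earlier, through the value of its polynomial if at the
    same moment. *)
Lemma arb_outdegree v :
  #|[set u | [&& e v u, (arb_out u).1 == (arb_out v).1 &
              (arb_out u).2 <= (arb_out v).2]]| <= delta.
Proof.
have := arb_decides v; rewrite /arb_out; case Ev: (arb #|K| v) => [[c i]|//] _ /=.
have [_ _ /= ci] := arbP Ev; apply: leq_trans; apply: subset_leq_card.
apply/subsetP => u; rewrite !inE => /and3P[-> /=].
have := arb_decides u; case Eu: (arb #|K| u) => [[c' i']|//] _ /= /eqP<- le.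
have [lt some /= ci' _] := arbP Eu.
rewrite /conflict; case E: (arb i u) => [p|].
  have lei : i <= #|K| by apply: ltnW; case: (arbP Ev).
  by move: Eu; rewrite (arb_mono lei E) => -[->] /=.
move: le; rewrite leq_eqVlt => /orP[/eqP ii|lt']; first by rewrite ci' ii.
by move: E; rewrite (arb_mono lt' some).
Qed.
End Graph.

End Arbdefective.

(** * Colouring one class *)

Lemma local_alg_arb (X : Type) (F : algorithm X) (Rel : X -> X -> bool)
    (psi : X -> nat) k delta (K : finFieldType) r i : local_alg F r ->
  local_alg (fun I v => arb k delta K (adjR F Rel (I := I))
                          (fun u => psi (F I u)) i v) (r + i).
Proof.
move=> locF; elim: i => [|i IH]; first by apply: (local_alg_mono _ (local_alg_const None)).
rewrite addnS.
pose G : algorithm (X * option (K * nat)) := fun I v =>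
  (F I v, arb k delta K (adjR F Rel (I := I)) (fun u => psi (F I u)) i v).
have locG : local_alg G (r + i).
  by apply: local_alg_pair => //; apply: (local_alg_mono _ locF); apply: leq_addr.
have := local_alg_step (fun x cnt => arb_step k delta i (psi x.1, x.2)
   (fun P => cnt (fun y => Rel x.1 y.1 && P (psi y.1, y.2)))) locG.
move/local_algP=> h; apply/local_algP => I1 I2 f v V1 V2 iso.
move: (h _ _ _ _ V1 V2 iso) => /=; rewrite /nbr_count /G /adjR /=.
move=> E; apply: etrans (etrans E _); congr arb_step; apply/funext => P;
  by apply: eq_card => u; rewrite !inE andbA.
Qed.

Section ClassStep.
Variables (L C : finFieldType) (m k d b delta : nat) (Pal : {set L * L}).
Hypotheses (mL : m < #|L| ^ k) (sizePal : d < #|Pal|)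
  (kdb : 2 * (k * delta * #|L|) <= b).

Variables (X : Type) (Rel : X -> X -> bool) (psi : X -> nat)
  (cls : X -> C) (tau : X -> nat) (col : X -> option (L * L)) (j : C).

(** The point over [t] of the graph of the polynomial of [a] raised by [s]. For fixed [a] the graphs
    for the various [s] partition the plane. *)
Definition translate (a : nat) (s t : L) : L * L := (t, (color_fun k a t + s)%R).

Definition free (x : X) (cnt : (X -> bool) -> nat) (p : L * L) : bool :=
  (p \in Pal) && (cnt (fun y => Rel x y && (col y == Some p)) == 0).

(** Only uncoloured vertices of class [j] with many uncoloured neighbours take part. The translate
    must have more free points than [delta] rivals can spoil. *)
Definition pick_shift (x : X) (cnt : (X -> bool) -> nat) : option L :=
  if [&& cls x == j, col x == None &
         b < 2 * (cnt (fun y => Rel x y && (col y == None))).+1]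
  then [pick s | k * delta < #|[set t | free x cnt (translate (psi x) s t)]|]
  else None.

Definition rival (x : X) (s t : L) (y : X * option L) : bool :=
  [&& Rel x y.1, cls y.1 == cls x, tau y.1 <= tau x &
   if y.2 is Some s' then translate (psi y.1) s' t == translate (psi x) s t
   else false].

Definition pick_color (z : X * option L) (cnt : (X * option L -> bool) -> nat) :
  option (L * L) :=
  if z.2 is Some s then
    omap (translate (psi z.1) s)
      [pick t | free z.1 (fun P => cnt (fun y => P y.1)) (translate (psi z.1) s t)
                && (cnt (rival z.1 s t) == 0)]
  else col z.1.

(** Two rounds: shifts are announced first, then each participant picks a point knowing the whole
    translates of its neighbours. *)
Definition class_colored (F : algorithm X) : algorithm (option (L * L)) :=
  let G : algorithm (X * option L) :=
    fun I v => (F I v, pick_shift (F I v) (nbr_count F v)) in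
  fun I v => pick_color (G I v) (nbr_count G v).

Lemma local_alg_class_colored (F : algorithm X) r :
  local_alg F r -> local_alg (class_colored F) r.+2.
Proof.
move=> locF; apply: (local_alg_step pick_color); apply: local_alg_pair.
  exact: local_alg_mono locF.
exact: local_alg_step.
Qed.

Section Correctness.
Variables (F : algorithm X) (I : instance).
Arguments F : clear implicits.
Let e := adjR F Rel (I := I).
Let colI v := col (F I v).
Let psiI v := psi (F I v).
Let udeg (c : ivert I -> option (L * L)) v := #|[set u | e v u & c u == None]|.

Hypotheses (eC : symmetric e)
  (psim : forall v, psiI v < m)
  (psiP : forall v u, e v u -> psiI v <> psiI u)
  (deg : forall v, #|[set u | e v u]| <= d)
  (colP : forall v u p, e v u -> colI v = Some p -> colI u <> Some p)
  (colPal : forall v p, colI v = Some p -> p \in Pal)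
  (outdeg : forall v, colI v = None ->
     #|[set u | [&& e v u, colI u == None, cls (F I u) == cls (F I v) &
                 tau (F I u) <= tau (F I v)]]| <= delta).

Let col' := class_colored F (I := I).
Let sh v := pick_shift (F I v) (nbr_count F v).
Let freeI v p := (p \in Pal) && [forall u, e v u ==> (colI u != Some p)].

Lemma count_adjR (P : pred X) v :
  nbr_count F v (fun y => Rel (F I v) y && P y) = #|[set u | e v u & P (F I u)]|.
Proof. by apply: eq_card => u; rewrite !inE andbA. Qed.

Lemma freeE v p : free (F I v) (nbr_count F v) p = freeI v p.
Proof.
rewrite /free /freeI (count_adjR (fun y => col y == Some p)); congr andb.
rewrite cards_eq0; apply/eqP/forallP => [/setP h u|h].
  by have := h u; rewrite !inE => /negbT; rewrite negb_and -implybE.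
apply/setP => u; rewrite !inE; apply/negbTE; rewrite negb_and -implybE.
exact: h.
Qed.

Lemma card_free v : udeg colI v < #|[set p | freeI v p]|.
Proof.
pose used := [set p in Pal | [exists u, e v u && (colI u == Some p)]].
have PalE : #|Pal| = #|used| + #|[set p | freeI v p]|.
  rewrite -(cardsID [set p | [exists u, e v u && (colI u == Some p)]] Pal).
  congr (_ + _); apply: eq_card => p; rewrite !inE /freeI; case: (p \in Pal) => //=; last by rewrite andbF.
  rewrite andbT negb_exists; apply: eq_forallb => u.
  by rewrite negb_and implybE.
have usedE : #|used| <= #|[set u | e v u & colI u != None]|.
  pose h u := odflt (0%R, 0%R) (colI u).
  apply: leq_trans _ (leq_imset_card h [set u | e v u & colI u != None]).
  apply: subset_leq_card; apply/subsetP => q.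
  rewrite inE => /andP[_ /existsP[u /andP[vu /eqP E]]].
  by apply/imsetP; exists u; rewrite ?inE ?vu /h ?E.
have := deg v; rewrite -(cardsID [set u | colI u == None]) => h.
have h1 : #|[set u | e v u] :&: [set u | colI u == None]| = udeg colI v.
  by apply: eq_card => u; rewrite !inE.
have h2 : #|[set u | e v u] :\: [set u | colI u == None]| =
    #|[set u | e v u & colI u != None]|.
  by apply: eq_card => u; rewrite !inE andbC.
by lia.
Qed.

Lemma shP v s : sh v = Some s -> [/\ cls (F I v) = j, colI v = None &
  k * delta < #|[set t | freeI v (translate (psiI v) s t)]|].
Proof.
rewrite /sh /pick_shift; case: ifP => // /and3P[/eqP-> /eqP cN _].
case: pickP => // s' gt [<-]; split=> //; apply: leq_trans gt _.
by apply: subset_leq_card; apply/subsetP => t; rewrite !inE freeE.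
Qed.

Lemma class_colored_eq v : sh v = None -> col' v = colI v.
Proof. by rewrite /col' /class_colored /pick_color /= -/(sh v) => ->. Qed.

(** A vertex with a shift always finds a colour: two translates meet in at most [k] points, so at
    most [delta] rivals spoil at most [k * delta] of its free points. *)
Lemma class_colored_shift v s : sh v = Some s ->
  exists t, [/\ col' v = Some (translate (psiI v) s t),
    freeI v (translate (psiI v) s t) &
    forall u s', e v u -> cls (F I u) = cls (F I v) -> tau (F I u) <= tau (F I v) ->
      sh u = Some s' -> translate (psiI u) s' t != translate (psiI v) s t].
Proof.
move=> E; have [clsv colv many] := shP E.
rewrite /col' /class_colored /pick_color /= -/(sh v) E.
set cnt := nbr_count _ _.
have cntF : (fun P => cnt (fun y => P y.1)) = nbr_count F v by [].
case: pickP => [t /andP[]|no].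
  rewrite cntF freeE => fr cnt0; exists t; split=> // u s' vu cu tu su.
  apply: contraL cnt0 => tr; rewrite -lt0n card_gt0; apply/set0Pn; exists u.
  by move: vu => /andP[uv Ruv]; rewrite inE uv /rival /= Ruv cu eqxx tu -/(sh u) su.
pose A := [set u | [&& e v u, colI u == None, cls (F I u) == cls (F I v) &
                 tau (F I u) <= tau (F I v)]].
(* The equation between the two translates, solved for the polynomial of [u] to match
   [color_fun_agree]. *)
pose B u := [set t | if sh u is Some s' then
   color_fun k (psiI u) t == (color_fun k (psiI v) t + (s - s'))%R else false].
case: (@exists_good_point _ _ [set t | freeI v (translate (psiI v) s t)] A B k).
- move=> u; rewrite inE => /and4P[vu _ _ _]; rewrite /B; case: (sh u) => [s'|].
    apply: (color_fun_agree mL) => //; apply/eqP => E'; exact: (psiP vu).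
  by rewrite (_ : [set t | false] = set0) ?cards0 //; apply/setP => t; rewrite !inE.
- apply: leq_ltn_trans many; rewrite mulnC leq_mul2l; apply/orP; right.
  exact: outdeg.
move=> t; rewrite inE => fr good; move: (no t).
rewrite cntF freeE fr /= => /negbT/negP[].
rewrite cards_eq0; apply/eqP/setP => u; rewrite !inE; apply/negP.
rewrite /rival /= -/(sh u) => /and4P[vu Ruv cu /andP[tu]].
case Eu: (sh u) => [s'|//] => /eqP[tr].
have [_ colu _] := shP Eu.
have /good : u \in A by rewrite inE /e /adjR vu Ruv cu tu colu eqxx.
rewrite inE Eu => /negP[]; apply/eqP.
by rewrite GRing.addrA -tr GRing.addrK.
Qed.

Lemma class_colored_extends v p : colI v = Some p -> col' v = Some p.
Proof.
case E: (sh v) => [s|]; last by rewrite (class_colored_eq E).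
by have [_ -> _] := shP E.
Qed.

Lemma class_colored_Pal v p : col' v = Some p -> p \in Pal.
Proof.
case E: (sh v) => [s|]; last by rewrite (class_colored_eq E); apply: colPal.
by have [t [-> /andP[Pp _] _]] := class_colored_shift E; move=> [<-].
Qed.

(** Of two neighbours coloured in the same step, the one whose [tau] is not smaller has avoided the
    other's translate over its own [t], hence any point that the other can choose. *)
Lemma class_colored_proper v u p : e v u -> col' v = Some p -> col' u <> Some p.
Proof.
have free_old w x s q : e w x -> sh w = Some s -> sh x = None ->
    col' w = Some q -> col' x <> Some q.
  move=> wx Ew Ex; rewrite (class_colored_eq Ex).
  have [t [-> /andP[_ /forallP/(_ x)/implyP/(_ wx)/eqP h] _]] := class_colored_shift Ew.
  by move=> [<-].
have both w x s s' q : e w x -> sh w = Some s -> sh x = Some s' ->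
    tau (F I x) <= tau (F I w) -> col' w = Some q -> col' x <> Some q.
  move=> wx Ew Ex tx.
  have [clw _ _] := shP Ew; have [clx _ _] := shP Ex.
  have [t [-> _ h]] := class_colored_shift Ew; move=> [<-].
  have [t' [-> _ _]] := class_colored_shift Ex; move=> [tt' E].
  have := h x s' wx (etrans clx (esym clw)) tx Ex.
  by rewrite /translate; rewrite tt' in E; rewrite E eqxx.
move=> vu; have uv : e u v by rewrite eC.
case Ev: (sh v) => [s|]; case Eu: (sh u) => [s'|].
- case: (leqP (tau (F I u)) (tau (F I v))) => [le|/ltnW le].
    exact: (both _ _ _ _ _ vu Ev Eu le).
  by move=> cv cu; apply: (both _ _ _ _ _ uv Eu Ev le cu cv).
- exact: (free_old _ _ _ _ vu Ev Eu).
- by move=> cv cu; apply: (free_old _ _ _ _ uv Eu Ev cu cv).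
- by rewrite !class_colored_eq //; apply: colP.
Qed.

(** Otherwise [v] would have tried, and no translate would have more than [k * delta] free points.
    As the translates partition the plane, at most [k * delta * #|L|] points would be free, against
    [card_free] and [kdb]. *)
Lemma class_colored_udeg v : cls (F I v) = j -> col' v = None ->
  2 * (udeg col' v).+1 <= b.
Proof.
move=> clv cv; case E: (sh v) => [s|].
  by have [t [cv' _ _]] := class_colored_shift E; rewrite cv' in cv.
have le : udeg col' v <= udeg colI v.
  apply: subset_leq_card; apply/subsetP => u; rewrite !inE => /andP[->] /=.
  by case Eu: (colI u) => [p|//]; rewrite (class_colored_extends Eu).
rewrite leqNgt; apply/negP => lt.
have att : b < 2 * (udeg colI v).+1 by apply: (leq_trans lt); lia.
have cIv : colI v = None by rewrite -(class_colored_eq E).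
move: E; rewrite /sh /pick_shift clv eqxx -/(colI v) cIv eqxx /=.
rewrite (count_adjR (fun y => col y == None)) att; case: pickP => // no _.
have few s : #|[set t | freeI v (translate (psiI v) s t)]| <= k * delta.
  rewrite leqNgt; apply/negP => lt'; have /negbT/negP[] := no s.
  apply: leq_trans lt' _; apply: subset_leq_card; apply/subsetP => t.
  by rewrite !inE freeE.
have : #|[set p | freeI v p]| <= k * delta * #|L|.
  rewrite mulnC -sum_nat_const.
  apply: leq_trans _ (leq_sum _ (fun s _ => few s)).
  rewrite -sum1_card.
  under [leqRHS]eq_bigr => s _ do rewrite -sum1_card big_mkcond /=.
  (* The change of variables from [(s, t)] to the point of the plane is the bijection behind the
     partition into translates. *)
  rewrite pair_big /= (reindex (fun st : L * L => translate (psiI v) st.1 st.2)) /=.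
    rewrite big_mkcond /=; apply: leq_sum => -[s t] _ /=.
    by rewrite !inE.
  exists (fun p : L * L => (p.2 - color_fun k (psiI v) p.1, p.1)%R) => -[s t] _ /=.
    by rewrite /translate /= GRing.addrAC GRing.subrr GRing.add0r.
  by rewrite /translate /= GRing.addrC GRing.subrK.
have := card_free v; lia.
Qed.
End Correctness.
End ClassStep.

(** * Colouring with one more colour than the degree *)

Definition partial_coloring (V P : finType) (e : rel V) (Pal : {set P})
    (c : V -> option P) : Prop :=
  (forall v u p, e v u -> c v = Some p -> c u <> Some p) /\
  (forall v p, c v = Some p -> p \in Pal).

Definition uncolored_degree (V P : finType) (e : rel V) (c : V -> option P) v :=
  #|[set u | e v u & c u == None]|.

Lemma uncolored_degree_anti (V P : finType) (e : rel V) (c c' : V -> option P) v :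
  (forall u p, c u = Some p -> c' u = Some p) ->
  uncolored_degree e c' v <= uncolored_degree e c v.
Proof.
move=> ext; apply: subset_leq_card; apply/subsetP => u; rewrite !inE => /andP[->] /=.
by case E: (c u) => [p|//]; rewrite (ext _ _ E).
Qed.

Section Phases.
Variables (L K : finFieldType) (m k d : nat) (Pal : {set L * L}).
Hypotheses (mL : m < #|L| ^ k) (mK : m < #|K| ^ k) (sizePal : d < #|Pal|).

Variables (X : Type) (F : algorithm X) (Rel : X -> X -> bool) (psi : X -> nat).
Arguments F : clear implicits.

Definition colorable_instance (I : instance) : Prop :=
  [/\ symmetric (adjR F Rel (I := I)), forall v, psi (F I v) < m,
     forall v u, adjR F Rel v u -> psi (F I v) <> psi (F I u) &
     forall v, #|[set u | adjR F Rel (I := I) v u]| <= d].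

(** Induction on the list of classes, at two rounds per class. Colours are only ever added, so the
    outdegree bound and the degree bounds already obtained survive later steps. *)
Lemma color_classes (b delta : nat) (G : algorithm (K * nat)) (js : seq K) :
  2 * (k * delta * #|L|) <= b ->
  forall r (c : algorithm (option (L * L))),
  local_alg F r -> local_alg G r -> local_alg c r ->
  exists2 c' : algorithm (option (L * L)), local_alg c' (r + 2 * size js) &
  forall I : instance, colorable_instance I ->
    partial_coloring (adjR F Rel (I := I)) Pal (c I) ->
    (forall v, c I v = None ->
      #|[set u | [&& adjR F Rel v u, c I u == None, (G I u).1 == (G I v).1 &
                     (G I u).2 <= (G I v).2]]| <= delta) ->
    [/\ partial_coloring (adjR F Rel (I := I)) Pal (c' I),
       forall v p, c I v = Some p -> c' I v = Some p &
       forall v, (G I v).1 \in js -> c' I v = None ->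
         2 * (uncolored_degree (adjR F Rel (I := I)) (c' I) v).+1 <= b].
Proof.
move=> kdb; elim: js => [|j js IH] r c locF locG locc.
  exists c; first by rewrite muln0 addn0.
  by move=> I CI cP od; split.
pose F3 : algorithm (X * (K * nat) * option (L * L)) :=
  fun I v => (F I v, G I v, c I v).
pose Rel3 (x y : X * (K * nat) * option (L * L)) := Rel x.1.1 y.1.1.
pose psi3 (x : X * (K * nat) * option (L * L)) := psi x.1.1.
pose cls3 (x : X * (K * nat) * option (L * L)) := x.1.2.1.
pose tau3 (x : X * (K * nat) * option (L * L)) := x.1.2.2.
pose c1 := class_colored k b delta Pal Rel3 psi3 cls3 tau3 snd j F3.
have loc1 : local_alg c1 r.+2.
  by apply: local_alg_class_colored; do 2?apply: local_alg_pair.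
have [||c' loc' hc'] := IH r.+2 c1 _ _ loc1.
- by apply: local_alg_mono locF; rewrite -addn2 leq_addr.
- by apply: local_alg_mono locG; rewrite -addn2 leq_addr.
exists c'; first by apply: local_alg_mono loc'; rewrite /=; lia.
move=> I [eC psim psiP deg] [cP cPal] outdeg.
have ext1 : forall v p, c I v = Some p -> c1 I v = Some p.
  move=> v p; exact: (@class_colored_extends _ _ k b delta Pal _ Rel3 psi3 cls3 tau3 snd j F3).
have c1P : partial_coloring (adjR F Rel (I := I)) Pal (c1 I).
  split.
    move=> v u p vu.
    exact: (@class_colored_proper _ _ _ _ _ _ _ mL _ Rel3 psi3 cls3 tau3 snd j F3 I
      eC psim psiP cP outdeg _ _ _ vu).
  move=> v p; exact: (@class_colored_Pal _ _ _ _ _ _ _ mL _ Rel3 psi3 cls3 tau3 snd j F3 I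
      psim psiP cPal outdeg).
have [||c'P ext' js'] := hc' I _ c1P; first by split.
  move=> v; case E: (c I v) => [p|] ; first by rewrite (ext1 _ _ E).
  move=> _; apply: leq_trans (outdeg v E); apply: subset_leq_card.
  apply/subsetP => u; rewrite !inE => /and4P[-> cu -> ->]; rewrite andbT /=.
  by move: cu; case Eu: (c I u) => [p|//]; rewrite (ext1 _ _ Eu).
split=> //; first by move=> v p /ext1/ext'.
move=> v; rewrite inE => /orP[/eqP vj|]; last exact: js'.
move=> c'v; have c1v : c1 I v = None.
  by case E: (c1 I v) => [p|//]; rewrite (ext' _ _ E) in c'v.
have := @class_colored_udeg _ _ _ _ _ _ _ _ mL sizePal kdb _ Rel3 psi3 cls3 tau3 snd j F3 I
  psim psiP deg outdeg v vj c1v.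
by apply: leq_trans; rewrite leq_mul2l ltnS; apply: uncolored_degree_anti.
Qed.

(* One phase: an arbdefective colouring of the uncoloured vertices, whose classes
   are then coloured one after the other; only vertices with many uncoloured
   neighbours, hence with many free colours, choose a colour. *)
Lemma color_phase (b r : nat) (c : algorithm (option (L * L))) :
  0 < k -> 4 * k ^ 2 * #|L| <= #|K| -> local_alg F r -> local_alg c r ->
  exists2 c' : algorithm (option (L * L)), local_alg c' (r + 3 * #|K|) &
  forall I : instance, colorable_instance I ->
    partial_coloring (adjR F Rel (I := I)) Pal (c I) ->
    (forall v, c I v = None ->
       uncolored_degree (adjR F Rel (I := I)) (c I) v < b) ->
    partial_coloring (adjR F Rel (I := I)) Pal (c' I) /\
    (forall v, c' I v = None ->
       uncolored_degree (adjR F Rel (I := I)) (c' I) v < b %/ 2).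
Proof.
(* The largest [delta] that [color_classes] allows; its maximality and [4 * k ^ 2 * #|L| <= #|K|]
   give the condition [big] of the arbdefective colouring. *)
move=> k0 kK locF locc; pose delta := b %/ (2 * k * #|L|).
have L0 : 0 < #|L| by apply/card_gt0P; exists 0%R.
have kdb : 2 * (k * delta * #|L|) <= b.
  rewrite (_ : _ * _ = delta * (2 * k * #|L|)) ?leq_trunc_div //; lia.
have big : 2 * k * b.-1 < #|K| * delta.+1.
  have : b < delta.+1 * (2 * k * #|L|) by rewrite -ltn_divLR ?muln_gt0 ?k0.
  move: kK k0; rewrite expnS expn1; set D := delta.+1; set l := #|L|; set q := #|K|.
  move=> kK k0 bD; apply: (@leq_trans (4 * (k * k) * l * D)); last first.
    by rewrite leq_mul2r kK orbT.
  apply: (@leq_ltn_trans (2 * k * b)); first by rewrite leq_mul2l leq_pred orbT.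
  apply: (@leq_trans (2 * k * (D * (2 * k * l)))); last by lia.
  by rewrite ltn_pmul2l ?muln_gt0.
pose F2 : algorithm (X * option (L * L)) := fun I v => (F I v, c I v).
pose Rel2 (x y : X * option (L * L)) := [&& Rel x.1 y.1, x.2 == None & y.2 == None].
pose G : algorithm (K * nat) := fun I v =>
  arb_out k delta K (adjR F2 Rel2 (I := I)) (fun u => psi (F2 I u).1) v.
have locG : local_alg G (r + #|K|).
  apply: (@local_alg_map _ _ (odflt (0%R, 0))).
  by apply: (@local_alg_arb _ F2 Rel2 (fun x => psi x.1)); apply: local_alg_pair.
have [||c' loc' hc'] := color_classes (enum K) kdb (r := r + #|K|) (c := c) _ locG.
- by apply: local_alg_mono locF; apply: leq_addr.
- by apply: local_alg_mono locc; apply: leq_addr.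
(* [#|K|] rounds for the arbdefective colouring and two for each of the [#|K|] classes. *)
exists c'; first by apply: local_alg_mono loc'; rewrite -cardE -addnA -mulSn.
move=> I CI cP ub; have [eC psim psiP deg] := CI.
have e2 v u : adjR F2 Rel2 v u = [&& adjR F Rel v u, c I v == None & c I u == None].
  by rewrite /adjR /Rel2 /= -andbA.
have [|c'P ext js] := hc' I CI cP.
  move=> v cv.
  have := @arb_outdegree m k delta K mK _ (adjR F2 Rel2 (I := I))
            (fun u => psi (F2 I u).1) b.-1 psim _ _ big v.
  rewrite -/(G I) => h.
  have {h} : #|[set u | [&& adjR F2 Rel2 v u, (G I u).1 == (G I v).1 &
                (G I u).2 <= (G I v).2]]| <= delta.
    apply: h; first by move=> x y; rewrite e2 => /and3P[xy _ _]; apply: psiP.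
    move=> x; case E: (c I x) => [p|]; last first.
      have := ub _ E; case: (b) => // b'; rewrite ltnS /=; apply: leq_trans.
      by apply: subset_leq_card; apply/subsetP => y; rewrite !inE e2 E => /and3P[-> _ ->].
    rewrite (_ : [set _ | _] = set0) ?cards0 //; apply/setP => y.
    by rewrite !inE e2 E andbF.
  by apply: leq_trans; apply: subset_leq_card; apply/subsetP => u; rewrite !inE e2 cv -!andbA.
split=> // v c'v; rewrite leq_divRL // mulnC; apply: js => //.
by rewrite mem_enum.
Qed.

Lemma color_phases (i r : nat) :
  0 < k -> 4 * k ^ 2 * #|L| <= #|K| -> local_alg F r ->
  exists2 c : algorithm (option (L * L)), local_alg c (r + i * (3 * #|K|)) &
  forall I : instance, colorable_instance I ->
    partial_coloring (adjR F Rel (I := I)) Pal (c I) /\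
    (forall v, c I v = None ->
       uncolored_degree (adjR F Rel (I := I)) (c I) v < d.+1 %/ 2 ^ i).
Proof.
move=> k0 kK locF; elim: i => [|i [c locc hc]].
  exists (fun I v => None); first exact: local_alg_mono (local_alg_const _).
  move=> I [_ _ _ deg]; split; first by split.
  move=> v _; rewrite divn1 ltnS; apply: leq_trans (deg v).
  by apply: subset_leq_card; apply/subsetP => u; rewrite !inE => /andP[].
have locF' : local_alg F (r + i * (3 * #|K|)).
  by apply: local_alg_mono locF; apply: leq_addr.
have [c' locc' hc'] := color_phase (d.+1 %/ 2 ^ i) k0 kK locF' locc.
exists c'; first by rewrite mulSnr addnA.
move=> I CI; have [cP ub] := hc I CI.
by rewrite expnSr divnMA; apply: hc'.
Qed.

(** After [(trunc_log 2 d.+1).+1] halvings the strict bound on the uncoloured degree is [0], so no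
    vertex is left uncoloured. *)
Lemma color_graph (r : nat) :
  0 < k -> 4 * k ^ 2 * #|L| <= #|K| -> #|Pal| = d.+1 -> local_alg F r ->
  exists2 c : algorithm nat, local_alg c (r + (trunc_log 2 d.+1).+1 * (3 * #|K|)) &
  forall I : instance, colorable_instance I ->
    (forall v u, adjR F Rel v u -> c I v <> c I u) /\ (forall v, c I v <= d).
Proof.
move=> k0 kK cardPal locF.
have [c locc hc] := color_phases (trunc_log 2 d.+1).+1 k0 kK locF.
exists (fun I v => if c I v is Some p then index p (enum Pal) else 0).
  exact: (@local_alg_map _ _ (fun o => if o is Some p then index p (enum Pal) else 0)).
move=> I CI; have [[cP cPal] ub] := hc I CI.
have some v : c I v <> None.
  move=> /ub; rewrite divn_small // trunc_log_ltn //.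
split=> [v u vu|v].
  case Ev: (c I v) => [p|]; last by have := some v.
  case Eu: (c I u) => [q|]; last by have := some u.
  have pP : p \in enum Pal by rewrite mem_enum; apply: cPal Ev.
  have qP : q \in enum Pal by rewrite mem_enum; apply: cPal Eu.
  move=> /(congr1 (nth p (enum Pal))); rewrite !nth_index // => pq.
  by apply: (cP _ _ _ vu Ev); rewrite pq.
case Ev: (c I v) => [p|//]; rewrite -ltnS -cardPal cardE index_mem mem_enum.
exact: cPal Ev.
Qed.
End Phases.

(** * Round counts and the initial colouring *)

Lemma exists_field_pow2 j : 0 < j -> exists K : finFieldType, #|K| = 2 ^ j.
Proof. by move=> j0; have [K _ cK] := PrimePowerField (isT : prime 2) j0; exists K. Qed.

(** The number of phases times a bound on [3 * #|K|]: the field [K] has at most [8 * k ^ 2] times as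
    many elements as [L], whose order, the last factor, is about [sqrt d]. *)
Definition base_rounds (k d : nat) : nat :=
  (trunc_log 2 d.+1).+1 * (24 * k ^ 2 * 2 ^ (trunc_log 2 d.+1)./2.+1).

Lemma base_rounds_mono k k' d d' : k <= k' -> d <= d' ->
  base_rounds k d <= base_rounds k' d'.
Proof.
move=> kk dd; have le : trunc_log 2 d.+1 <= trunc_log 2 d'.+1 by apply: leq_trunc_log.
rewrite /base_rounds leq_mul ?ltnS // leq_mul ?leq_mul ?leq_exp2r //.
by rewrite leq_exp2l // ltnS half_leq.
Qed.

(** [L] has [2 ^ j] elements with [d < 2 ^ (2 * j)], so the plane holds [d.+1] palette points; [K]
    is larger by a power of two between [4 * k ^ 2] and [8 * k ^ 2]. As the old colours have [k]
    bits, [k] coefficients suffice over both fields. *)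
Lemma base_coloring (m k d : nat) (X : Type) (F : algorithm X)
    (Rel : X -> X -> bool) (psi : X -> nat) r :
  0 < k -> m < 2 ^ k -> local_alg F r ->
  exists2 c : algorithm nat, local_alg c (r + base_rounds k d) &
  forall I : instance, colorable_instance m d F Rel psi I ->
    (forall v u, adjR F Rel v u -> c I v <> c I u) /\ (forall v, c I v <= d).
Proof.
move=> k0 mk locF; set j := (trunc_log 2 d.+1)./2.+1.
have [L cL] := @exists_field_pow2 j isT.
have [|K cK] := @exists_field_pow2 (up_log 2 (4 * k ^ 2) + j).
  by rewrite /j addnS.
have up1 : 4 * k ^ 2 <= 2 ^ up_log 2 (4 * k ^ 2) by apply: up_logP.
have up2 : 2 ^ up_log 2 (4 * k ^ 2) <= 8 * k ^ 2.
  have gt1 : 1 < 4 * k ^ 2 by apply: (@leq_trans (4 * 1)); rewrite // leq_mul2l expn_gt0 k0.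
  have := up_log_gtn (isT : 1 < 2) gt1.
  have : 0 < up_log 2 (4 * k ^ 2) by rewrite up_log_gt0.
  by case: (up_log _ _) => // u _; rewrite [2 ^ u.+1]expnS /=; set x := 2 ^ u; set y := k ^ 2; lia.
have pow (Q : finFieldType) i : #|Q| = 2 ^ i.+1 -> m < #|Q| ^ k.
  move=> ->; apply: (leq_trans mk); rewrite leq_exp2r // expnS.
  by rewrite -[X in X <= _]muln1 leq_mul2l expn_gt0.
have mL : m < #|L| ^ k by apply: pow cL.
have mK : m < #|K| ^ k by apply: (@pow _ (up_log 2 (4 * k ^ 2) + (trunc_log 2 d.+1)./2)); rewrite cK /j addnS.
have card : d.+1 <= #|{: L * L}|.
  rewrite card_prod cL -expnD; apply: ltnW; apply: leq_trans (trunc_log_ltn d.+1 (isT : 1 < 2)) _.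
  by rewrite leq_exp2l // /j; have := odd_double_half (trunc_log 2 d.+1); lia.
have [s [us ss _]] := card_geqP card.
pose Pal := [set p in s].
have cPal : #|Pal| = d.+1 by rewrite cardsE (card_uniqP us).
have kK : 4 * k ^ 2 * #|L| <= #|K| by rewrite cL cK expnD leq_mul2r up1 orbT.
have [c locc hc] := color_graph mL mK (ltac:(by rewrite cPal) : d < #|Pal|) Rel psi k0 kK cPal locF.
exists c => //; apply: local_alg_mono locc; rewrite leq_add2l leq_mul2l /=.
by rewrite cK expnD -/j; move: up2; set a := 2 ^ _; set b := 2 ^ _; nia.
Qed.

(** * Iterating Linial's step *)

Definition linial_log (Delta L : nat) : nat := 2 * (trunc_log 2 (L.+1 * Delta)).+1.

(** Colours of [L] bits become polynomials with [L.+1] coefficients over a field whose order is a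
    power of two above [L.+1 * Delta]; a point of the plane over it has [linial_log Delta L]
    bits. *)
Lemma linial_iter (Delta L : nat) (F : algorithm nat) r i : local_alg F r ->
  exists2 F' : algorithm nat, local_alg F' (r + i) &
  forall I : instance, (forall v u, iadj I v u -> F I v <> F I u) ->
    (forall v, F I v < 2 ^ L) -> (forall v, #|[set u | iadj I v u]| <= Delta) ->
    (forall v u, iadj I v u -> F' I v <> F' I u) /\
    (forall v, F' I v < 2 ^ iter i (linial_log Delta) L).
Proof.
move=> locF; elim: i => [|i [F' locF' hF']].
  by exists F => //; rewrite addn0.
set Li := iter i (linial_log Delta) L in hF' *.
have [K cK] := @exists_field_pow2 (trunc_log 2 (Li.+1 * Delta)).+1 isT.
have kK : Li.+1 * Delta < #|K| by rewrite cK; apply: trunc_log_ltn.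
have mK : 2 ^ Li < #|K| ^ Li.+1.
  rewrite cK -expnM ltn_exp2l // mulSn; apply: leq_trans (leq_addr _ _); lia.
have [F2 locF2 hF2] := linial_step mK kK locF'.
exists F2; first by rewrite addnS.
move=> I h1 h2 h3; have [h4 h5] := hF' I h1 h2 h3.
have [h6 h7] := hF2 I h4 h5 h3; split=> // v.
by rewrite iterS -/Li /linial_log mulnC expnM -cK.
Qed.

Lemma trunc_logM a b : trunc_log 2 (a * b) <= trunc_log 2 a + trunc_log 2 b + 1.
Proof.
case: a => [|a]; first by rewrite mul0n trunc_log0.
case: b => [|b]; first by rewrite muln0 trunc_log0.
rewrite -ltnS -(@ltn_exp2l 2) //; apply: leq_ltn_trans (trunc_logP _ _) _ => //.
have := trunc_log_ltn a.+1 (isT : 1 < 2); have := trunc_log_ltn b.+1 (isT : 1 < 2).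
move=> hb ha; rewrite addn1 -addnS -addSn expnD.
by apply: ltn_mul.
Qed.

Lemma trunc_log_lt n : 0 < n -> trunc_log 2 n < n.
Proof.
by move=> n0; apply: leq_trans (ltn_expl _ (isT : 1 < 2)) (trunc_logP _ _).
Qed.

Lemma pow_expn n : Nat.pow 2 n = 2 ^ n.
Proof. by elim: n => //= n ->; rewrite expnS mul2n -addnn /=; lia. Qed.

Lemma trunc_log_log2 n : trunc_log 2 n <= Nat.log2 n.
Proof.
case: n => [|n]; first by rewrite trunc_log0.
have h : n.+1 < 2 ^ (Nat.log2 n.+1).+1.
  have [_ /ltP] := PeanoNat.Nat.log2_spec n.+1 (PeanoNat.Nat.lt_0_succ n).
  by rewrite pow_expn.
rewrite -ltnS -(@ltn_exp2l 2) //; apply: leq_ltn_trans h.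
exact: trunc_logP.
Qed.

(** One step replaces [y] by its logarithm and keeps the rest of the bound. The factor [2 ^ a]
    survives because the logarithm turns it into [a], and [2 * a + 12 <= 2 ^ a] from [a = 5] on. *)
Lemma linial_log_le a Delta L y : 5 <= a -> 0 < y ->
  L <= 2 ^ a * (y + trunc_log 2 Delta + 1) ->
  linial_log Delta L <= 2 ^ a * (trunc_log 2 y + trunc_log 2 Delta + 1).
Proof.
move=> a5 y0 hL; set l := trunc_log 2 Delta in hL *.
have A32 : 2 * a + 12 <= 2 ^ a.
  elim: a a5 {hL} => // a IH; rewrite leq_eqVlt => /orP[/eqP[<-] //|a5].
  by have := IH a5; rewrite expnS; lia.
have pos : 0 < 2 ^ a by rewrite expn_gt0.
have h1 : L.+1 <= 2 ^ a.+1 * (y * l.+2).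
  rewrite expnS; move: pos hL; set A := 2 ^ a; clearbody A; move=> pos hL.
  have : y + l + 1 <= y * l.+2 by case: y y0 {hL} => // y _; nia.
  by set B := y * l.+2; nia.
have h2 : trunc_log 2 L.+1 <= a.+1 + (trunc_log 2 y + l.+1 + 1) + 1.
  apply: leq_trans (leq_trunc_log 2 h1) _; apply: leq_trans (trunc_logM _ _) _.
  rewrite trunc_expnK // !leq_add //; apply: leq_trans (trunc_logM _ _) _.
  by rewrite !leq_add // -ltnS trunc_log_lt.
have h3 := trunc_logM L.+1 Delta; rewrite -/l in h3.
rewrite /linial_log; move: A32 pos h2 h3.
set A := 2 ^ a; set T := trunc_log 2 (_ * _); set U := trunc_log 2 _.
set W := trunc_log 2 y; move=> *; nia.
Qed.

Lemma iter_log2_logstar n : iter (logstar n) Nat.log2 n <= 1.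
Proof.
rewrite /logstar; suff H f m : m <= f -> iter (logstar_aux f m) Nat.log2 m <= 1 by apply: H.
elim: f m => [|f IH] m; first by rewrite leqn0 => /eqP->.
move=> le /=; case: ifP => // /negbT; rewrite -ltnNge => m1.
rewrite iterSr; apply: IH; rewrite -ltnS; apply: leq_trans le.
have : (Nat.log2 m < m)%coq_nat by apply: PeanoNat.Nat.log2_lt_lin; lia.
by lia.
Qed.

Lemma iter_log2_lt_logstar n j : j < logstar n -> 1 < iter j Nat.log2 n.
Proof.
rewrite /logstar; suff H f m i : i < logstar_aux f m -> 1 < iter i Nat.log2 m by apply: H.
elim: f m i => [//|f IH] m i /=; case: ifP => // /negbT; rewrite -ltnNge => m1.
by case: i => [//|i]; rewrite ltnS iterSr; apply: IH.
Qed.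

(** Iterates [linial_log_le] with [y] running through the iterated logarithms of [n], which are
    positive before step [logstar n] and at most [1] at that step. *)
Lemma linial_iter_le a Delta L n : 5 <= a -> L <= 2 ^ a * n.+1 ->
  iter (logstar n) (linial_log Delta) L <= 2 ^ a * (trunc_log 2 Delta + 2).
Proof.
move=> a5 hL; set l := trunc_log 2 Delta.
suff H i : (forall j, j < i -> 0 < iter j Nat.log2 n) ->
    iter i (linial_log Delta) L <= 2 ^ a * (iter i Nat.log2 n + l + 1).
  apply: leq_trans (H _ _) _; last first.
    by rewrite leq_mul2l; have := iter_log2_logstar n; lia.
  by move=> j /iter_log2_lt_logstar/ltnW.
elim: i => [|i IH] h /=; first by apply: leq_trans hL _; rewrite leq_mul2l; lia.
apply: (@leq_trans (2 ^ a * (trunc_log 2 (iter i Nat.log2 n) + l + 1))).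
  by apply: linial_log_le => //; [apply: h|apply: IH => j ji; apply: h; apply: ltnW].
by rewrite leq_mul2l !leq_add2r trunc_log_log2 orbT.
Qed.

Lemma linial_coloring a Delta L n (F : algorithm nat) r : local_alg F r ->
  5 <= a -> L <= 2 ^ a * n.+1 ->
  exists2 F' : algorithm nat, local_alg F' (r + logstar n) &
  forall I : instance, (forall v u, iadj I v u -> F I v <> F I u) ->
    (forall v, F I v < 2 ^ L) -> (forall v, #|[set u | iadj I v u]| <= Delta) ->
    (forall v u, iadj I v u -> F' I v <> F' I u) /\
    (forall v, F' I v < 2 ^ (2 ^ a * (trunc_log 2 Delta + 2))).
Proof.
move=> locF a5 hL; have [F' locF' hF'] := linial_iter Delta L (logstar n) locF.
exists F' => // I h1 h2 h3; have [h4 h5] := hF' I h1 h2 h3; split=> // v.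
by apply: leq_trans (h5 v) _; rewrite leq_exp2l // linial_iter_le.
Qed.

(** * Splitting clubs *)

Lemma card_has_le (T : finType) (L : Type) (s : seq L) (B : L -> {set T}) k :
  (forall l, #|B l| <= k) -> #|[set t | has (fun l => t \in B l) s]| <= size s * k.
Proof.
move=> h; elim: s => [|l s IH] /=.
  by rewrite (_ : [set t | false] = set0) ?cards0 //; apply/setP => t; rewrite !inE.
have -> : [set t | (t \in B l) || has (fun l => t \in B l) s] =
          B l :|: [set t | has (fun l => t \in B l) s].
  by apply/setP => t; rewrite !inE.
by rewrite cardsU mulSn; apply: leq_trans (leq_subr _ _) _; rewrite leq_add.
Qed.

Section Stages.
Variables (X : Type) (Lam : eqType) (F : algorithm X) (ident psi : X -> nat)
  (mem : X -> Lam -> bool) (Delta D m k : nat).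
Arguments F : clear implicits.
Hypotheses (k0 : 0 < k) (mk : m < 2 ^ k).

(** Clubs are labels, and membership is read off a vertex's own state; this covers maximal cliques
    and, on line graphs, stars at once. *)
Definition club_instance (I : instance) : Prop :=
  [/\ symmetric (iadj I), injective (fun v => ident (F I v)),
     (forall v, psi (F I v) < m) /\
     (forall v u, iadj I v u -> psi (F I v) <> psi (F I u)),
     (forall v u, iadj I v u <->
        v <> u /\ exists l, mem (F I v) l /\ mem (F I u) l) &
     (forall v, #|[set u | iadj I v u]| <= Delta) /\
     (forall v, exists2 s : seq Lam, size s <= D & forall l, mem (F I v) l -> l \in s)].

Definition club_size (Y : eqType) (G : algorithm Y) (S : nat) (I : instance) : Prop :=
  forall l p, #|[set v | mem (F I v) l & G I v == p]| <= S.

(** The minimum with [Delta] keeps the logarithm of the degree polylogarithmic in [Delta]. *)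
Definition stage_rounds (d : nat) : nat := base_rounds k (minn Delta d).

Lemma stage_rounds_mono d d' : d <= d' -> stage_rounds d <= stage_rounds d'.
Proof. by move=> le; apply: base_rounds_mono => //; rewrite leq_min geq_minl geq_min le orbT. Qed.

Lemma color_club_subgraph (Z : Type) (H : algorithm Z) (Rel : Z -> Z -> bool)
    (pi : Z -> X) (d r : nat) :
  (forall I v, pi (H I v) = F I v) -> local_alg H r ->
  exists2 c : algorithm nat, local_alg c (r + stage_rounds d) &
  forall I : instance, club_instance I ->
    symmetric (adjR H Rel (I := I)) ->
    (forall v, #|[set u | adjR H Rel (I := I) v u]| <= d) ->
    (forall v u, adjR H Rel v u -> c I v <> c I u) /\ (forall v, c I v <= d).
Proof.
move=> piH locH.
have [c locc hc] := base_coloring (minn Delta d) Rel (psi \o pi) k0 mk locH.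
exists c => // I [_ _ [psim psiP] _ [degD _]] sym deg.
have [|h1 h2] := hc I; last first.
  by split=> // v; apply: leq_trans (h2 v) (geq_minr _ _).
split=> //= [v|v u /andP[vu _]|v]; rewrite ?piH //; first exact: psiP.
rewrite leq_min deg andbT; apply: leq_trans (degD v).
by apply: subset_leq_card; apply/subsetP => u; rewrite !inE => /andP[].
Qed.

(** Inside a class of [G] a vertex has at most [S.-1] neighbours in each of its at most [D]
    clubs. *)
Lemma final_stage (Y : eqType) (G : algorithm Y) (S r : nat) :
  local_alg F r -> local_alg G r ->
  exists2 c : algorithm nat, local_alg c (r + stage_rounds (D * S.-1)) &
  forall I : instance, club_instance I -> club_size G S I ->
    (forall v u, iadj I v u -> G I v = G I u -> c I v <> c I u) /\
    (forall v, c I v <= D * S.-1).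
Proof.
move=> locF locG; pose H : algorithm (X * Y) := fun I v => (F I v, G I v).
have [||c locc hc] := @color_club_subgraph _ H (fun x y => x.2 == y.2) fst (D * S.-1) r.
- by [].
- exact: local_alg_pair.
exists c => // I CI cS; have [sym _ _ cl [_ few]] := CI.
have [||h1 h2] := hc I CI.
- by move=> v u; rewrite /adjR /= sym eq_sym.
- move=> v; have [s sD hs] := few v.
  pose B l := [set u | [&& mem (F I u) l, G I u == G I v & mem (F I v) l]] :\ v.
  have cB l : #|B l| <= S.-1.
    rewrite /B; case E: (mem (F I v) l); last first.
      rewrite (_ : _ :\ _ = set0) ?cards0 //; apply/setP => u.
      by rewrite !inE !andbF.
    have vin : v \in [set u | [&& mem (F I u) l, G I u == G I v & true]].
      by rewrite !inE E eqxx.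
    have := cardsD1 v [set u | [&& mem (F I u) l, G I u == G I v & true]].
    rewrite vin => e; have := cS l (G I v).
    have -> : [set u | mem (F I u) l & G I u == G I v] =
              [set u | [&& mem (F I u) l, G I u == G I v & true]].
      by apply/setP => u; rewrite !inE andbT.
    by rewrite e; case: (S).
  apply: (@leq_trans (size s * S.-1)); last by rewrite leq_mul2r sD orbT.
  apply: leq_trans _ (card_has_le s cB); apply: subset_leq_card.
  apply/subsetP => u; rewrite !inE => /andP[/cl[vu [l [vl ul]]] /= Guv].
  apply/hasP; exists l; first exact: hs.
  have uv : u != v by apply/eqP => uv; apply: vu; rewrite uv.
  by rewrite eq_sym in Guv; rewrite !inE ul vl Guv uv.
by split=> // v u vu Gvu; apply: h1; rewrite /adjR /= vu Gvu eqxx.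
Qed.

(* The members of a club with the same current colour are ranked by identifier
   and grouped [t] by [t]; a new colour appears at most once in each group. *)
Lemma split_stage (Y : eqType) (G : algorithm Y) (S t r : nat) :
  0 < t -> local_alg F r -> local_alg G r ->
  exists2 c : algorithm nat, local_alg c (r.+1 + stage_rounds (D * t.-1)) &
  forall I : instance, club_instance I -> club_size G S I ->
    club_size (fun I v => (G I v, c I v)) (S.-1 %/ t).+1 I /\
    (forall v, c I v <= D * t.-1).
Proof.
move=> t0 locF locG; pose H0 : algorithm (X * Y) := fun I v => (F I v, G I v).
pose rank (x : X * Y) (cnt : (X * Y -> bool) -> nat) (l : Lam) : nat :=
  cnt (fun y => [&& mem y.1 l, y.2 == x.2 & ident y.1 < ident x.1]).
pose rk : algorithm (Lam -> nat) := fun I v => rank (H0 I v) (nbr_count H0 v).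
pose H : algorithm (X * Y * (Lam -> nat)) := fun I v => (F I v, G I v, rk I v).
pose grp (x y : X * Y * (Lam -> nat)) := (x.1.2 == y.1.2) &&
  `[< exists l, [/\ mem x.1.1 l, mem y.1.1 l & x.2 l %/ t = y.2 l %/ t] >].
have locH : local_alg H r.+1.
  apply: local_alg_pair; last by apply: (local_alg_step rank); apply: local_alg_pair.
  by apply: local_alg_pair; [apply: local_alg_mono locF|apply: local_alg_mono locG].
have [//|c locc hc] := @color_club_subgraph _ H grp (fun x => x.1.1) (D * t.-1) r.+1 _ locH.
exists c => // I CI cS; have [sym inj _ cl [_ few]] := CI.
have rkE v l : mem (F I v) l -> rk I v l =
    #|[set u | [&& mem (F I u) l, G I u == G I v & ident (F I u) < ident (F I v)]]|.
  move=> vl; apply: eq_card => u; rewrite !inE /=.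
  case ul: (mem (F I u) l); rewrite ?andbF //=.
  case lt: (_ < _); rewrite ?andbF //= !andbT.
  case: (G I u == G I v); rewrite ?andbF //= andbT.
  by apply/cl; split; [move=> E; rewrite E ltnn in lt|exists l].
have rk_lt v u l : mem (F I v) l -> mem (F I u) l -> G I v = G I u ->
    ident (F I v) < ident (F I u) -> rk I v l < rk I u l.
  move=> vl ul Gvu lt; rewrite !rkE //; apply: proper_card; apply/properP; split.
    apply/subsetP => w; rewrite !inE -Gvu => /and3P[-> -> lt'] /=.
    exact: ltn_trans lt' lt.
  by exists v; rewrite !inE ?ltnn ?andbF // vl Gvu eqxx lt.
have rk_inj v u l : mem (F I v) l -> mem (F I u) l -> G I v = G I u ->
    rk I v l = rk I u l -> v = u.
  move=> vl ul Gvu E; apply: inj.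
  case: (ltngtP (ident (F I v)) (ident (F I u))) => // lt.
    by have := rk_lt _ _ _ vl ul Gvu lt; rewrite E ltnn.
  by have := rk_lt _ _ _ ul vl (esym Gvu) lt; rewrite E ltnn.
have [||h1 h2] := hc I CI.
- move=> v u; rewrite /adjR /grp /= sym eq_sym; congr [&& _, _ & _].
  by apply/asboolP/asboolP => -[l [? ? ?]]; exists l.
- move=> v; have [s sD hs] := few v.
  pose A l := [set u | [&& mem (F I u) l, G I u == G I v, mem (F I v) l &
                    rk I u l %/ t == rk I v l %/ t]].
  have cA l : #|A l :\ v| <= t.-1.
    case E: (mem (F I v) l); last first.
      rewrite (_ : _ :\ _ = set0) ?cards0 //; apply/setP => u.
      by rewrite !inE E !andbF.
    have cA : #|A l| <= t.
      (* Members of one group differ in their rank modulo [t]; [t.-1.+1] is [t] in the form that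
         [inord] needs. *)
      pose h u := inord (rk I u l %% t) : 'I_t.-1.+1.
      rewrite -[leqRHS](prednK t0) -[leqRHS]card_ord.
      apply: (@leq_card_in _ _ h) => u w; rewrite !inE => /and4P[ul /eqP Gu _ /eqP qu].
      move=> /and4P[wl /eqP Gw _ /eqP qw] /(congr1 val) /=.
      rewrite !inordK ?prednK ?ltn_pmod // => md.
      apply: (rk_inj _ _ l) => //; first by rewrite Gu Gw.
      by rewrite (divn_eq (rk I u l) t) (divn_eq (rk I w l) t) md qu qw.
    have := cardsD1 v (A l); have -> : v \in A l by rewrite !inE E !eqxx.
    by move=> e; move: cA; rewrite e; case: (t) t0.
  apply: (@leq_trans (size s * t.-1)); last by rewrite leq_mul2r sD orbT.
  apply: leq_trans _ (card_has_le s cA); apply: subset_leq_card.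
  apply/subsetP => u; rewrite !inE /adjR /grp /= => /and3P[/cl[vu _] /eqP Guv].
  move=> /asboolP[l [vl ul q]].
  apply/hasP; exists l; first exact: hs.
  have uv : u != v by apply/eqP => uv; apply: vu; rewrite uv.
  by rewrite !inE ul vl q Guv uv !eqxx.
split=> // l [p q].
pose B := [set v | mem (F I v) l & (G I v, c I v) == (p, q)].
(* Members of a club that agree in both colours lie in different groups. Ranks are at most [S.-1],
   which leaves [(S.-1 %/ t).+1] groups, the ceiling of [S / t] for positive [S]. *)
pose h v := inord (rk I v l %/ t) : 'I_(S.-1 %/ t).+1.
rewrite -[leqRHS]card_ord; apply: (@leq_card_in _ _ h) => v u.
rewrite !inE => /andP[vl /eqP[Gv cv]] /andP[ul /eqP[Gu cu]] /(congr1 val) /=.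
have rkS w : mem (F I w) l -> G I w = p -> rk I w l <= S.-1.
  move=> wl Gw; rewrite -ltnS; have S0 : 0 < S.
    apply: leq_trans (cS l p); apply/card_gt0P; exists w.
    by rewrite inE wl Gw eqxx.
  rewrite prednK //; apply: leq_trans (cS l p); rewrite rkE //.
  apply: proper_card; apply/properP; split.
    by apply/subsetP => x; rewrite !inE Gw => /and3P[-> ->].
  by exists w; rewrite !inE ?ltnn ?andbF // wl Gw eqxx.
rewrite !inordK ?ltnS ?leq_div2r ?rkS // => E.
apply/eqP/negPn/negP => /eqP vu; apply: (h1 v u); last by rewrite cv cu.
rewrite /adjR /grp /= Gv Gu eqxx /=; apply/andP; split; first by apply/cl; split=> //; exists l.
by apply/asboolP; exists l.
Qed.
End Stages.

(** With [a = t - 1] and [b] the quotient, the claim reduces to [D * a + b + 1 <= D * b + D], which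
    follows from [2 <= D] and [2 * a + 1 <= b]; the latter is where [2 * t ^ 2 <= S] enters. *)
Lemma split_colors_le D t S : 2 <= D -> 0 < t -> 2 * t ^ 2 <= S ->
  (D * t.-1).+1 * (S.-1 %/ t).+1 <= D * S.
Proof.
move=> D2 t0 tS; set b := S.-1 %/ t.
have bt : b * t <= S.-1 by apply: leq_trunc_div.
have hb : 2 * t - 1 <= b by rewrite leq_divRL //; move: tS; rewrite expnS expn1; nia.
clearbody b; have S0 : 0 < S by apply: leq_trans tS; rewrite muln_gt0 expn_gt0 t0.
apply: (@leq_trans (D * (b * t).+1)); last by rewrite leq_mul2l; lia.
case: t t0 hb {bt tS} => // a _ hb; case: D D2 => [|[|D]] // _ /=.
have : 2 * a + 1 <= b by lia.
by move=> h; nia.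
Qed.

(** Counts a split and the final stage together: the factor [D ^ 2] leaves enough room that
    [t.-1 <= b] replaces the stronger bound of [split_colors_le]. *)
Lemma split_sqrt_colors_le D t S : 2 <= D -> 0 < t -> t ^ 2 <= S ->
  (D * t.-1).+1 * (D * (S.-1 %/ t)).+1 <= D ^ 2 * S.
Proof.
move=> D2 t0 tS; set b := S.-1 %/ t.
have bt : b * t <= S.-1 by apply: leq_trunc_div.
have hb : t.-1 <= b by rewrite leq_divRL //; move: tS; rewrite expnS expn1; nia.
clearbody b; have S0 : 0 < S by apply: leq_trans tS; rewrite expn_gt0 t0.
rewrite [D ^ 2]expnS expn1.
apply: (@leq_trans (D * D * (b * t).+1)); last by rewrite leq_mul2l; lia.
case: t t0 hb {bt tS} => // a _ /= hb; case: D D2 => [|[|D]] // _.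
have -> : D.+2 * D.+2 * (b * a.+1).+1 =
  (D.+2 * a).+1 * (D.+2 * b).+1 + ((D.+2 * D.+2 - D.+2) * b + (D.+2 * D.+2 - 1) - D.+2 * a).
  have h1 : D.+2 * a <= D.+2 * b by rewrite leq_mul2l hb.
  have h2 : D.+2 * D.+2 - D.+2 = D.+2 * D.+1 by lia.
  have h3 : D.+2 * b <= D.+2 * D.+1 * b by nia.
  by rewrite h2; nia.
exact: leq_addr.
Qed.

Lemma sqrt_floor S : 0 < S -> exists s, [/\ 0 < s, s ^ 2 <= S & S < s.+1 ^ 2].
Proof.
move=> S0; have ex : exists s, s ^ 2 <= S by exists 0.
have bd s : s ^ 2 <= S -> s <= S.
  by apply: leq_trans; rewrite expnS expn1; case: s => // s; rewrite leq_pmulr.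
case: (ex_maxnP ex bd) => s sS max; exists s; split=> //.
  by case: s max {sS} => // /(_ 1) /=; rewrite exp1n => /(_ S0).
by rewrite ltnNge; apply/negP => /max; rewrite ltnn.
Qed.

(** * The recursion over the stages *)

Section Recursion.
Variables (X : Type) (Lam : eqType) (F : algorithm X) (ident psi : X -> nat)
  (mem : X -> Lam -> bool) (Delta D m k : nat).
Arguments F : clear implicits.
Hypotheses (k0 : 0 < k) (mk : m < 2 ^ k) (D2 : 2 <= D).

Let good := club_instance F ident psi mem Delta D m.
Let csize (Y : eqType) (G : algorithm Y) := club_size F mem G.
Let T d := stage_rounds Delta k d.

Lemma combine_colors (Y : eqType) (G : algorithm Y) (c1 c2 : algorithm nat)
    (M1 M2 : nat) (I : instance) :
  (forall v, c1 I v <= M1) -> (forall v, c2 I v < M2) ->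
  (forall v u, iadj I v u -> (G I v, c1 I v) = (G I u, c1 I u) -> c2 I v <> c2 I u) ->
  (forall v u, iadj I v u -> G I v = G I u -> c1 I v * M2 + c2 I v <> c1 I u * M2 + c2 I u) /\
  (forall v, c1 I v * M2 + c2 I v < M1.+1 * M2).
Proof.
move=> h1 h2 h3; split=> [v u vu Gvu E|v]; last first.
  apply: (@leq_trans (c1 I v * M2 + M2)); first by rewrite ltn_add2l.
  by rewrite -mulSnr leq_mul2r ltnS h1 orbT.
have M0 : 0 < M2 by apply: leq_ltn_trans (h2 v).
have c1E : c1 I v = c1 I u.
  by have := congr1 (divn^~ M2) E; rewrite !divnMDl // !divn_small ?h2 // !addn0.
apply: (h3 v u vu); first by rewrite Gvu c1E.
by move: E; rewrite c1E => /addnI.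
Qed.

(** Induction on [y] with invariant [S <= t ^ y.+1]: a split by [t] leaves clubs of size at most
    [t ^ y]. The case [S < 2 * t ^ 2] ends at once, by a split at the square root and a final stage.
    All stages colour graphs of degree at most [D * (2 * t)], hence the common round bound. *)
Lemma stages (t : nat) : 0 < t ->
  forall (y S r : nat) (Y : eqType) (G : algorithm Y), 0 < S -> S <= t ^ y.+1 ->
  local_alg F r -> local_alg G r ->
  exists2 c : algorithm nat, local_alg c (r + y.+1 * (T (D * (2 * t))).+1) &
  forall I : instance, good I -> csize G S I ->
    (forall v u, iadj I v u -> G I v = G I u -> c I v <> c I u) /\
    (forall v, c I v < D ^ y.+1 * S).
Proof.
move=> t0; set T0 := T _; elim=> [|y IH] S r Y G S0 St locF locG.
  have [c locc hc] := final_stage ident psi mem Delta D k0 mk S locF locG.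
  exists c.
    apply: local_alg_mono locc; rewrite leq_add2l mul1n; apply: leqW.
    by apply: stage_rounds_mono; rewrite leq_mul2l; move: St; rewrite expn1; lia.
  move=> I gI sI; have [h1 h2] := hc I gI sI; split=> // v.
  apply: leq_ltn_trans (h2 v) _; rewrite expn1 ltn_pmul2l ?prednK //.
  exact: leq_trans D2.
have step t' : 0 < t' -> t' <= 2 * t -> exists2 c1 : algorithm nat,
    local_alg c1 (r + T0.+1) &
    forall I, good I -> csize G S I ->
      csize (fun I v => (G I v, c1 I v)) (S.-1 %/ t').+1 I /\
      (forall v, c1 I v <= D * t'.-1).
  move=> t'0 t'2.
  have [c1 locc1 hc1] := split_stage ident psi mem Delta D k0 mk S t'0 locF locG.
  exists c1 => //; apply: local_alg_mono locc1; rewrite addSnnS leq_add2l ltnS.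
  by apply: stage_rounds_mono; rewrite leq_mul2l; apply/orP; right; lia.
case: (leqP (2 * t ^ 2) S) => [big|small].
  have [|c1 locc1 hc1] := step t t0; first by lia.
  pose G1 : algorithm (Y * nat)%type := fun I v => (G I v, c1 I v).
  have [| | | |c2 locc2 hc2] := IH (S.-1 %/ t).+1 (r + T0.+1) _ G1.
  - by [].
  - by rewrite ltn_divLR // -expnSr; apply: leq_trans St; rewrite prednK.
  - by apply: local_alg_mono locF; apply: leq_addr.
  - by apply: local_alg_pair => //; apply: local_alg_mono locG; apply: leq_addr.
  pose M2 := D ^ y.+1 * (S.-1 %/ t).+1.
  exists (fun I v => c1 I v * M2 + c2 I v).
    apply: (@local_alg_map _ _ (fun p => p.1 * M2 + p.2) (fun I v => (c1 I v, c2 I v))).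
    apply: local_alg_pair; last by rewrite mulSn addnA.
    by apply: local_alg_mono locc1; rewrite mulSn addnA leq_addr.
  move=> I gI sI; have [s1 b1] := hc1 I gI sI.
  have [p2 b2] := hc2 I gI s1.
  have [h1 h2] := combine_colors b1 b2 p2; split=> // v.
  apply: leq_trans (h2 v) _; rewrite [D ^ y.+2]expnSr /M2 -mulnA.
  by rewrite mulnCA leq_mul2l (split_colors_le D2 t0 big) orbT.
have [s [s0 sS Ss]] := sqrt_floor S0.
have s2t : s < 2 * t.
  rewrite ltnNge; apply/negP => le.
  have : (2 * t) ^ 2 <= s ^ 2 by rewrite leq_exp2r.
  rewrite expnMn => h; have := leq_trans h sS; move: small; lia.
have [|c1 locc1 hc1] := step s s0; first exact: ltnW.
pose G1 : algorithm (Y * nat)%type := fun I v => (G I v, c1 I v).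
have [||c2 locc2 hc2] := @final_stage _ _ F ident psi mem Delta D _ _ k0 mk _ G1
   (S.-1 %/ s).+1 (r + T0.+1).
- by apply: local_alg_mono locF; apply: leq_addr.
- by apply: local_alg_pair => //; apply: local_alg_mono locG; apply: leq_addr.
(* From [S < s.+1 ^ 2] the quotient is at most [s.+1], and [s < 2 * t]. *)
have le : stage_rounds Delta k (D * (S.-1 %/ s)) <= T0.
  apply: stage_rounds_mono; rewrite leq_mul2l; apply/orP; right.
  apply: leq_trans s2t; rewrite -ltnS ltn_divLR //; move: Ss s0.
  by rewrite expnS expn1; nia.
pose M2 := (D * (S.-1 %/ s)).+1.
exists (fun I v => c1 I v * M2 + c2 I v).
  apply: (@local_alg_map _ _ (fun p => p.1 * M2 + p.2) (fun I v => (c1 I v, c2 I v))).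
  rewrite !mulSn; apply: local_alg_pair.
    by apply: local_alg_mono locc1; lia.
  by apply: local_alg_mono locc2 => /=; lia.
move=> I gI sI; have [s1 b1] := hc1 I gI sI.
have [p2 b2] := hc2 I gI s1.
have b2' v : c2 I v < M2 by apply: b2.
have [h1 h2] := combine_colors b1 b2' p2; split=> // v.
apply: leq_trans (h2 v) _; apply: leq_trans (split_sqrt_colors_le D2 s0 sS) _.
by rewrite leq_mul2r leq_exp2l // orbT.
Qed.
End Recursion.

Lemma club_coloring (a n Delta D S x t L r0 : nat) (X : Type) (Lam : eqType)
    (F : algorithm X) (ident : X -> nat) (mem : X -> Lam -> bool) :
  5 <= a -> L <= 2 ^ a * n.+1 -> 2 <= D -> 0 < S -> 0 < t -> S <= t ^ x.+1 ->
  local_alg F r0 ->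
  let k := (2 ^ a * (trunc_log 2 Delta + 2)).+1 in
  exists2 c : algorithm nat, local_alg c
    (r0 + logstar n + x.+1 * (base_rounds k (minn Delta (D * (2 * t)))).+1) &
  forall I : instance,
    symmetric (iadj I) -> injective (fun v => ident (F I v)) ->
    (forall v, ident (F I v) < 2 ^ L) ->
    (forall v u, iadj I v u <-> v <> u /\ exists l, mem (F I v) l /\ mem (F I u) l) ->
    (forall v, #|[set u | iadj I v u]| <= Delta) ->
    (forall v, exists2 s : seq Lam, size s <= D & forall l, mem (F I v) l -> l \in s) ->
    (forall l, #|[set v | mem (F I v) l]| <= S) ->
    (forall v u, iadj I v u -> c I v <> c I u) /\ (forall v, c I v < D ^ x.+1 * S).
Proof.
move=> a5 hL D2 S0 t0 St locF k.
have locid : local_alg (fun I v => ident (F I v)) r0 by apply: local_alg_map.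
have [psi locpsi hpsi] := linial_coloring Delta locid a5 hL.
pose F' : algorithm (X * nat) := fun I v => (F I v, psi I v).
have locF' : local_alg F' (r0 + logstar n).
  by apply: local_alg_pair => //; apply: local_alg_mono locF; apply: leq_addr.
have mk : 2 ^ (2 ^ a * (trunc_log 2 Delta + 2)) < 2 ^ k by rewrite ltn_exp2l.
(* The recursion starts from a constant colouring, for which [club_size] bounds the whole clubs. *)
have loctt : local_alg (fun I v => tt) (r0 + logstar n).
  by apply: local_alg_mono (local_alg_const tt).
have [c locc hc] := @stages _ _ F' (fun p => ident p.1) snd (fun p => mem p.1) Delta D
  _ k isT mk D2 t t0 x S (r0 + logstar n) _ _ S0 St locF' loctt.
exists c => // I sym inj idL cl deg few size.
have inj' v u : iadj I v u -> ident (F I v) <> ident (F I u).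
  by move=> /cl[vu _] /inj.
have [p1 p2] := hpsi I inj' idL deg.
have [||h1 h2] := hc I; last by split=> // v u vu; apply: h1.
  by split.
move=> l p; apply: leq_trans (size l); apply: subset_leq_card.
by apply/subsetP => v; rewrite !inE => /andP[].
Qed.

(** * Maximal cliques *)

Lemma cliqueP (I : instance) (K : {set ivert I}) :
  reflect {in K &, forall u w, u != w -> iadj I u w} (clique K).
Proof.
apply: (iffP forall_inP) => [h u w uK wK|h u uK].
  by move: (h u uK) => /forall_inP/(_ w wK)/implyP.
by apply/forall_inP => w wK; apply/implyP; apply: h.
Qed.

Lemma maximal_cliqueP (I : instance) (K : {set ivert I}) :
  reflect (clique K /\ forall K', clique K' -> K \subset K' -> K' = K)
    (maximal_clique K).
Proof.
apply: (iffP andP) => -[cK h]; split=> //.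
  by move=> K' cK' sK; move: h => /forallP/(_ K'); rewrite cK' sK => /eqP.
by apply/forallP => K'; apply/implyP => /andP[c s]; apply/eqP; apply: h.
Qed.

Lemma clique_sub_maximal (I : instance) (K : {set ivert I}) :
  clique K -> exists2 K', maximal_clique K' & K \subset K'.
Proof.
move=> cK; have [K' /maxsetP[cK' max] sK] := maxset_exists cK.
by exists K' => //; apply/maximal_cliqueP.
Qed.

(** A clique is named by its sorted identifiers, so that its label is the same in every instance
    that shows the same view. *)
Definition id_list (I : instance) (K : {set ivert I}) : seq nat :=
  sort leq [seq iid u | u <- enum K].

Lemma id_list_eq (I1 I2 : instance) (K1 : {set ivert I1}) (K2 : {set ivert I2}) :
  valid I1 -> valid I2 ->
  id_list K1 = id_list K2 <->
  forall i, (exists2 u, u \in K1 & iid u = i) <-> (exists2 u, u \in K2 & iid u = i).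
Proof.
move=> [_ [_ inj1]] [_ [_ inj2]].
have memP (I : instance) (K : {set ivert I}) i :
    reflect (exists2 u, u \in K & iid u = i) (i \in [seq iid u | u <- enum K]).
  by apply: (iffP mapP) => -[u uK E]; exists u; rewrite ?E // mem_enum in uK *.
have sortP := perm_sortP leq_total leq_trans anti_leq.
split=> [/sortP/perm_mem E i|h].
  by split=> /memP h; apply/memP; [rewrite -E|rewrite E].
apply/sortP; apply: uniq_perm; rewrite ?map_inj_uniq ?enum_uniq //.
by move=> i; apply/memP/memP => /h.
Qed.

Lemma id_list_inj (I : instance) : valid I -> injective (@id_list I).
Proof.
move=> V K1 K2 /(id_list_eq _ _ V V) h; have [_ [_ inj]] := V.
apply/setP => u; apply/idP/idP => uK.
  by have [w wK /inj <-] := (h (iid u)).1 (ex_intro2 _ _ u uK erefl).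
by have [w wK /inj <-] := (h (iid u)).2 (ex_intro2 _ _ u uK erefl).
Qed.

Definition clique_label : algorithm (nat * (seq nat -> bool)) :=
  fun I v => (iid v, fun l => [exists K : {set ivert I},
                 [&& maximal_clique K, v \in K & l == id_list K]]).

Section CliqueTransport.
Variables (I1 I2 : instance) (f : ivert I1 -> ivert I2) (v : ivert I1).
Hypotheses (V1 : valid I1) (V2 : valid I2) (iso : view_iso f v 1).

Lemma clique_ball (I : instance) (K : {set ivert I}) u w :
  clique K -> u \in K -> w \in K -> w \in ball u 1.
Proof.
move=> /cliqueP cK uK wK; have [->|uw] := eqVneq w u; first exact: ball_center.
by apply: ball_adj; apply: cK => //; rewrite eq_sym.
Qed.

Lemma clique_image (K : {set ivert I1}) : v \in K -> clique K -> clique (f @: K).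
Proof.
move=> vK cK; have [_ _ adj _] := iso; apply/cliqueP => _ _ /imsetP[x xK ->] /imsetP[y yK ->].
move=> xy; rewrite adj ?(clique_ball cK vK) //.
have /cliqueP h := cK; apply: (h x y xK yK); apply: contraNneq xy => ->.
exact: eqxx.
Qed.

Lemma in_preimage (K : {set ivert I2}) u :
  (u \in [set x in ball v 1 | f x \in K]) = (u \in ball v 1) && (f u \in K).
Proof. exact: in_set. Qed.

Lemma clique_preimage (K : {set ivert I2}) : f v \in K -> clique K ->
  let K0 := [set u in ball v 1 | f u \in K] in clique K0 /\ f @: K0 = K.
Proof.
move=> vK cK K0; have [_ back adj _] := iso; split.
  apply/cliqueP => x y; rewrite !in_preimage => /andP[xb xK] /andP[yb yK] xy.
  rewrite -adj //; have /cliqueP h := cK; apply: (h _ _ xK yK).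
  by apply: contraNneq xy => /(view_iso_inj V1 iso xb yb) ->.
apply/setP => w; apply/imsetP/idP => [[u]|wK]; first by rewrite in_preimage => /andP[_ uK] ->.
have [u ub uw] := back w (clique_ball cK vK wK).
by exists u => //; rewrite in_preimage ub uw.
Qed.

(** All cliques through a vertex lie in its ball of radius [1], so a clique extending the image
    pulls back to one extending [K]. *)
Lemma maximal_clique_image (K : {set ivert I1}) :
  v \in K -> maximal_clique K -> maximal_clique (f @: K).
Proof.
move=> vK /maximal_cliqueP[cK max]; apply/maximal_cliqueP; split; first exact: clique_image.
move=> K' cK' sK; have vK' : f v \in K' by apply: (subsetP sK); apply: imset_f.
have [c0 e0] := clique_preimage vK' cK'.
suff e : [set u in ball v 1 | f u \in K'] = K by rewrite -[LHS]e0 e.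
apply: (max _ c0); apply/subsetP => u uK.
by rewrite in_preimage (clique_ball cK vK uK) (subsetP sK) // imset_f.
Qed.

Lemma maximal_clique_preimage (K : {set ivert I2}) :
  f v \in K -> maximal_clique K ->
  exists K0 : {set ivert I1}, [/\ v \in K0, maximal_clique K0 & f @: K0 = K].
Proof.
move=> vK /maximal_cliqueP[cK max]; have [c0 e0] := clique_preimage vK cK.
exists [set u in ball v 1 | f u \in K]; split=> //; first by rewrite in_preimage ball_center.
apply/maximal_cliqueP; split=> // K' cK' sK.
have vK' : v \in K' by apply: (subsetP sK); rewrite in_preimage ball_center.
have e' : f @: K' = K.
  by apply: max; [apply: clique_image|rewrite -e0 imsetS].
apply/setP => u; apply/idP/idP => [uK|/(subsetP sK)//].
by rewrite in_preimage (clique_ball cK' vK' uK) -e' imset_f.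
Qed.

Lemma id_list_image (K : {set ivert I1}) : v \in K -> clique K ->
  id_list (f @: K) = id_list K.
Proof.
move=> vK cK; have [_ _ _ ids] := iso; apply/id_list_eq => // i; split.
  move=> [_ /imsetP[u uK ->] <-]; exists u => //.
  by rewrite ids // (clique_ball cK vK uK).
move=> [u uK <-]; exists (f u); first exact: imset_f.
by rewrite ids // (clique_ball cK vK uK).
Qed.
End CliqueTransport.

Lemma local_alg_clique_label : local_alg clique_label 1.
Proof.
apply/local_algP => I1 I2 f v V1 V2 iso; rewrite /clique_label.
have [_ _ _ ids] := iso; rewrite ids ?ball_center //; congr pair; apply/funext => l.
apply/existsP/existsP => -[K /and3P[mK vK /eqP->]].
  exists (f @: K); rewrite (maximal_clique_image V1 iso) // imset_f //=.
  by rewrite (id_list_image V1 V2 iso) //; case/andP: mK.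
have [K0 [vK0 mK0 <-]] := maximal_clique_preimage V1 iso vK mK.
exists K0; rewrite mK0 vK0 /=.
by rewrite (id_list_image V1 V2 iso) //; case/andP: mK0.
Qed.

Lemma trunc_log_leq n : trunc_log 2 n <= n.
Proof. by case: n => [|n]; [rewrite trunc_log0|apply: ltnW; apply: trunc_log_lt]. Qed.

Lemma ids_bound_log c n : n ^ c <= 2 ^ (c * (trunc_log 2 n).+1).
Proof.
case: c => [|c]; first by rewrite mul0n !expn0.
by rewrite mulnC expnM leq_exp2r // ltnW // trunc_log_ltn.
Qed.

(** The clubs are the maximal cliques: every edge extends to one, a vertex lies in at most [D] of
    them, and they have at most [S] members. The constant [2 ^ (c + 10)] absorbs the factor [c] in
    the bit length of identifiers. *)
Lemma vertex_coloring_alg (c n Delta D S x t : nat) :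
  2 <= D -> 0 < S -> 0 < t -> S <= t ^ x.+1 ->
  let k := (2 ^ (c + 10) * (trunc_log 2 Delta + 2)).+1 in
  exists2 A : algorithm nat, local_alg A
    (1 + logstar n + x.+1 * (base_rounds k (minn Delta (D * (2 * t)))).+1) &
  forall I : instance, valid I -> #|ivert I| = n -> ids_bounded c I ->
    max_degree I = Delta -> max_diversity I = D -> max_clique_size I = S ->
    proper_vertex_coloring (A I) (D ^ x.+1 * S).
Proof.
move=> D2 S0 t0 St k; set L := c * (trunc_log 2 n).+1.
have hL : L <= 2 ^ (c + 10) * n.+1.
  apply: leq_mul; first by apply: ltnW; apply: leq_trans (ltn_expl c (isT : 1 < 2)) _; rewrite leq_exp2l // leq_addr.
  by rewrite ltnS trunc_log_leq.
have a5 : 5 <= c + 10 by apply: leq_trans (leq_addl _ _).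
have [A locA hA] := @club_coloring (c + 10) n Delta D S x t L 1 _ _ clique_label fst
  (fun p l => p.2 l) a5 hL D2 S0 t0 St local_alg_clique_label.
exists A => // I V cn idb degE divE cliE; have [sym [irr inj]] := V.
have [||||||h1 h2] := hA I sym.
- exact: inj.
- move=> v; apply: leq_trans (idb v) _; rewrite cn; exact: ids_bound_log.
- move=> v u; split=> [vu|[vu [l [/existsP[K1 /and3P[m1 vK /eqP->]]]]]].
    split=> [E|]; first by rewrite E irr in vu.
    have cK : clique [set v; u].
      apply/cliqueP => x1 x2; rewrite !inE => /orP[]/eqP-> /orP[]/eqP->; rewrite ?eqxx // => _.
      by rewrite sym.
    have [K mK sK] := clique_sub_maximal cK.
    exists (id_list K); split; apply/existsP; exists K; rewrite mK eqxx andbT /=.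
      by apply: (subsetP sK); rewrite !inE eqxx.
    by apply: (subsetP sK); rewrite !inE eqxx orbT.
  move=> /existsP[K2 /and3P[m2 uK /eqP/(id_list_inj V) E]]; rewrite -E in uK.
  by case/andP: m1 => /cliqueP cK _; apply: cK => //; apply/eqP.
- move=> v; rewrite -degE; exact: (@leq_bigmax _ (fun v => #|[set w | iadj I v w]|)).
- move=> v; exists [seq id_list K | K in [set K : {set ivert I} | maximal_clique K & v \in K]].
    rewrite size_image -divE; exact: (@leq_bigmax _ (fun v => diversity v)).
  move=> l /existsP[K /and3P[mK vK /eqP->]]; apply/imageP.
  by exists K => //; rewrite inE mK.
- move=> l; rewrite -cliE.
  have [->|/set0Pn[v]] := eqVneq [set v : ivert I | (clique_label v).2 l] set0; first by rewrite cards0.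
  rewrite inE => /existsP[K /and3P[mK _ /eqP lK]].
  have cK : clique K by case/andP: mK.
  apply: (@leq_trans #|K|); last exact: (@leq_bigmax_cond _ (fun K : {set ivert I} => clique K) (fun K => #|K|) K cK).
  apply: subset_leq_card; apply/subsetP => u; rewrite inE => /existsP[K' /and3P[_ uK' /eqP]].
  by rewrite lK => /(id_list_inj V) ->.
by split.
Qed.

(** * Line graphs *)

(** The value lies between consecutive squares, which determines [a + b] and then [a]; quadratic
    growth keeps the identifiers of the line graph polynomial in [n]. *)
Definition pair_code (a b : nat) : nat := (a + b) ^ 2 + a.

Lemma pair_code_inj a b a' b' : pair_code a b = pair_code a' b' -> a = a' /\ b = b'.
Proof.
rewrite /pair_code !expnS !expn0 !muln1 => E.
have : a + b = a' + b'.
  case: (ltngtP (a + b) (a' + b')) => // lt; exfalso.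
    have : (a + b).+1 * (a + b).+1 <= (a' + b') * (a' + b') by apply: leq_mul.
    by lia.
  have : (a' + b').+1 * (a' + b').+1 <= (a + b) * (a + b) by apply: leq_mul.
  by lia.
move=> s; rewrite s in E; move/addnI: E => E; split=> //; lia.
Qed.

(* The line graph lives on all ordered pairs of vertices; the pairs that are not
   edges oriented from the smaller to the larger identifier are isolated, and
   the parity of the identifier tells the two kinds apart. *)
Section LineInstance.
Variable I : instance.

Definition edge_pair (p : ivert I * ivert I) : bool :=
  iadj I p.1 p.2 && (iid p.1 < iid p.2).

Definition share_end (p q : ivert I * ivert I) : bool :=
  [|| p.1 == q.1, p.1 == q.2, p.2 == q.1 | p.2 == q.2].

Definition line_adj (p q : ivert I * ivert I) : bool :=
  [&& edge_pair p, edge_pair q, p != q & share_end p q].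

Definition line_id (p : ivert I * ivert I) : nat :=
  edge_pair p + (pair_code (iid p.1) (iid p.2)).*2.

Definition line_instance : instance := Instance line_adj line_id.

Lemma line_valid : valid I -> valid line_instance.
Proof.
move=> [sym [irr inj]]; split; last split.
- move=> p q; rewrite /= /line_adj /share_end (eq_sym q p).
  rewrite (eq_sym q.1) (eq_sym q.1) (eq_sym q.2) (eq_sym q.2).
  by case: (edge_pair p); case: (edge_pair q); case: (p != q) => //=; rewrite (orbCA (p.1 == q.2)).
- by move=> p; rewrite /= /line_adj eqxx !andbF.
move=> [p1 p2] [q1 q2]; rewrite /= /line_id => E.
have : pair_code (iid p1) (iid p2) = pair_code (iid q1) (iid q2).
  by move: E => /=; case: edge_pair; case: edge_pair; lia.
by move=> /pair_code_inj[/inj-> /inj->].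
Qed.
End LineInstance.

(** The clubs of a line graph are the stars, labelled by the identifier of their centre; an edge
    decodes its two centres from its own identifier. *)
Definition line_mem (i l : nat) : bool :=
  odd i && `[< exists a b, i./2 = pair_code a b /\ (l = a \/ l = b) >].

Lemma line_memP (I : instance) (p : ivert I * ivert I) l :
  line_mem (line_id p) l <-> edge_pair p /\ (l = iid p.1 \/ l = iid p.2).
Proof.
rewrite /line_mem /line_id oddD odd_double addbF.
have -> : (edge_pair p + (pair_code (iid p.1) (iid p.2)).*2)./2 =
          pair_code (iid p.1) (iid p.2).
  by case: edge_pair => /=; rewrite ?add0n ?doubleK // uphalf_double.
case: edge_pair => /=; last by split=> // -[].
split=> [/asboolP[a [b [/pair_code_inj[-> ->] h]]]|[_ h]]; first by split.
by apply/asboolP; exists (iid p.1), (iid p.2).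
Qed.

Section LineTransport.
Variables (I1 I2 : instance) (f : ivert I1 -> ivert I2) (u : ivert I1) (R : nat).
Hypotheses (V1 : valid I1) (V2 : valid I2) (iso : view_iso f u R.+2).

Definition pair_map (p : ivert I1 * ivert I1) : ivert I2 * ivert I2 := (f p.1, f p.2).

Definition ends_in (r : nat) (p : ivert I1 * ivert I1) : Prop :=
  p.1 \in ball u r /\ p.2 \in ball u r.

Lemma edge_pair_map p : ends_in R.+2 p -> edge_pair (pair_map p) = edge_pair p.
Proof.
move=> [b1 b2]; have [_ _ adj ids] := iso.
by rewrite /edge_pair /= adj // !ids.
Qed.

Lemma line_id_map p : ends_in R.+2 p -> line_id (pair_map p) = line_id p.
Proof.
move=> h; have [b1 b2] := h; have [_ _ _ ids] := iso.
by rewrite /line_id edge_pair_map //= !ids.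
Qed.

Lemma line_adj_map p q : ends_in R.+2 p -> ends_in R.+2 q ->
  line_adj (pair_map p) (pair_map q) = line_adj p q.
Proof.
move=> hp hq; rewrite /line_adj !edge_pair_map //.
have [p1 p2] := hp; have [q1 q2] := hq.
have inj x y : x \in ball u R.+2 -> y \in ball u R.+2 -> (f x == f y) = (x == y).
  by move=> xb yb; apply/eqP/eqP => [|->//]; apply: (view_iso_inj V1 iso).
by rewrite /share_end /pair_map /= !inj // xpair_eqE !inj // -xpair_eqE; case: p q {hp hq} p1 p2 q1 q2 => [? ?] [? ?].
Qed.

(** Consecutive edges share an end, so each step in the line graph takes the ends at most one step
    further from [u]. *)
Lemma line_ball_ends (e p : ivert (line_instance I1)) s :
  ends_in 1 e -> p \in ball e s -> ends_in s.+1 p.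
Proof.
move=> he; have [sym _] := V1.
elim: s p => [|s IH] p; first by rewrite in_ball0 => /eqP->.
rewrite in_ballS => /orP[/IH[p1 p2]|/existsP[q /andP[/IH[q1 q2] qp]]].
  by split; [apply: ball_mono p1|apply: ball_mono p2].
move: qp => /and4P[_ /andP[p12 _] _ sh].
have [z1|z2] : p.1 \in ball u s.+1 \/ p.2 \in ball u s.+1.
- by case/or4P: sh => /eqP <-; auto.
- by split; [apply: ball_mono z1|apply: ball_step z1 p12].
by split; [rewrite sym in p12; apply: ball_step z2 p12|apply: ball_mono z2].
Qed.

(** An edge of the second line graph that meets the image of an edge in view has both ends within
    the view of [f u], and so lifts end by end. *)
Lemma line_view_iso (e : ivert I1 * ivert I1) : ends_in 1 e ->
  view_iso (pair_map : ivert (line_instance I1) -> ivert (line_instance I2)) e R.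
Proof.
move=> he; have [sym2 _] := V2; have [_ back adj _] := iso.
have ends s (p : ivert (line_instance I1)) : s <= R.+1 ->
    p \in ball (e : ivert (line_instance I1)) s -> ends_in R.+2 p.
  move=> sR /(line_ball_ends he)[p1 p2].
  by split; [apply: ball_mono p1|apply: ball_mono p2].
apply: view_isoI.
- move=> p q pb pq qb.
  have hp := ends R p (leqnSn R) pb; have hq := ends R q (leqnSn R) qb.
  by rewrite /= line_adj_map.
- move=> s p q sR ps; have [p1 p2] := line_ball_ends he ps.
  have sR1 : s <= R.+1 by apply: leqW; apply: ltnW.
  have hp := ends s p sR1 ps.
  have [fwd _ _ _] : view_iso f u s.+1 by apply: view_iso_le iso; do 2!apply: leqW.
  move=> pq; have /and4P[_ /andP[q12 _] _ sh] := pq.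
  have sR2 : s.+2 <= R.+2 by apply: ltnW.
  have [q1 q2] : q.1 \in ball (f u) R.+2 /\ q.2 \in ball (f u) R.+2.
    have [z1|z2] : q.1 \in ball (f u) s.+1 \/ q.2 \in ball (f u) s.+1.
    - by case/or4P: sh => /eqP <-; rewrite /= ?fwd //; auto.
    - split; first by apply: ball_mono z1; apply: ltnW.
      by apply: (ball_mono sR2); apply: ball_step z1 q12.
    rewrite sym2 in q12; split; last by apply: ball_mono z2; apply: ltnW.
    by apply: (ball_mono sR2); apply: ball_step z2 q12.
  have [x1 x1b fx1] := back _ q1; have [x2 x2b fx2] := back _ q2.
  have qE : pair_map (x1, x2) = q by rewrite /pair_map /= fx1 fx2; case: (q).
  exists (x1, x2) => //; rewrite /= -line_adj_map //.
  by rewrite qE.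
- by move=> p q pb qb; apply: line_adj_map; apply: (ends R).
- by move=> p pb; apply: line_id_map; apply: (ends R).
Qed.
End LineTransport.

Definition orient (I : instance) (u w : ivert I) : ivert I * ivert I :=
  if iid u < iid w then (u, w) else (w, u).

(** Each endpoint simulates [A] on the line graph at its own edges; [orient] makes both endpoints
    query the same pair. The default [0] is for numbers that identify no neighbour. *)
Definition edge_output (A : algorithm nat) : algorithm (nat -> nat) :=
  fun I u j => if [pick w | iadj I u w && (iid w == j)] is Some w
               then A (line_instance I) (orient u w) else 0.

Lemma edge_outputE (A : algorithm nat) (I : instance) (u w : ivert I) :
  valid I -> iadj I u w -> edge_output A u (iid w) = A (line_instance I) (orient u w).
Proof.
move=> [_ [_ inj]] uw; rewrite /edge_output; case: pickP => [w' /andP[_ /eqP/inj ->]//|].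
by move=> /(_ w); rewrite uw eqxx.
Qed.

Lemma local_alg_edge_output (A : algorithm nat) R :
  local_alg A R -> local_alg (edge_output A) R.+2.
Proof.
move=> /local_algP locA; apply/local_algP => I1 I2 f u V1 V2 iso; apply/funext => j.
have [_ back adj ids] := iso.
have ub : u \in ball u R.+2 by apply: ball_center.
have nb w : iadj I1 u w -> w \in ball u R.+2.
  by move=> /ball_adj; apply: ball_mono.
have lift w' : iadj I2 (f u) w' -> exists2 w, iadj I1 u w & f w = w'.
  move=> uw'; have [w wb fw] : exists2 w, w \in ball u R.+2 & f w = w'.
    by apply: back; apply: ball_mono (ball_adj uw').
  by exists w => //; rewrite -adj ?fw.
rewrite {1}/edge_output; case: pickP => [w /andP[uw /eqP wj]|no].
  have uw2 : iadj I2 (f u) (f w) by rewrite adj // nb.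
  rewrite -wj -(ids w (nb w uw)) edge_outputE //.
  have he : ends_in u 1 (orient u w).
    by rewrite /orient; case: ifP => _; split; solve [exact: ball_center|exact: ball_adj].
  rewrite (locA _ _ _ _ (line_valid V1) (line_valid V2) (line_view_iso V1 V2 iso he)).
  by rewrite /pair_map /orient (ids u ub) (ids w (nb w uw)); case: ifP.
rewrite /edge_output; case: pickP => // w' /andP[uw' /eqP wj].
have [w uw fw] := lift w' uw'.
by have := no w; rewrite uw -(ids w (nb w uw)) fw wj eqxx.
Qed.

(** An edge lies in two stars of at most [Delta] edges, so the club colouring applies to the line
    graph with [2] for [D], [Delta] for [S] and degree bound [2 * Delta]. *)
Lemma edge_coloring_alg (c n Delta x t : nat) :
  0 < Delta -> 0 < t -> Delta <= t ^ x.+1 ->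
  let k := (2 ^ (c + 10) * (trunc_log 2 (2 * Delta) + 2)).+1 in
  exists2 A : algorithm (nat -> nat), local_alg A
    (logstar n + x.+1 * (base_rounds k (minn (2 * Delta) (2 * (2 * t)))).+1).+2 &
  forall I : instance, valid I -> #|ivert I| = n -> ids_bounded c I ->
    max_degree I = Delta -> proper_edge_coloring (A I) (2 ^ x.+1 * Delta).
Proof.
(* If identifiers are below [N = 2 ^ L0], a doubled pair code plus the parity bit stays below
   [16 * N ^ 2]. *)
move=> D0 t0 Dt k; set L0 := c * (trunc_log 2 n).+1; pose L := 2 * L0 + 4.
have hL : L <= 2 ^ (c + 10) * n.+1.
  apply: (@leq_trans ((2 * c + 4) * n.+1)).
    have h : (trunc_log 2 n).+1 <= n.+1 by rewrite ltnS trunc_log_leq.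
    by rewrite /L /L0; nia.
  rewrite leq_mul2r /= expnD; have := ltn_expl c (isT : 1 < 2).
  by rewrite (_ : 2 ^ 10 = 1024) //; set C := 2 ^ c; lia.
have a5 : 5 <= c + 10 by apply: leq_trans (leq_addl _ _).
have [A locA hA] := @club_coloring (c + 10) n (2 * Delta) 2 Delta x t L 0 _ _
  (fun I v => iid v) id line_mem a5 hL isT D0 t0 Dt local_alg_iid.
rewrite add0n in locA.
exists (edge_output A); first exact: local_alg_edge_output.
move=> I V cn idb degE; have [sym [irr inj]] := V.
have V' := line_valid V; have [sym' [irr' inj']] := V'.
have cl (p q : ivert (line_instance I)) : iadj (line_instance I) p q <->
    p <> q /\ exists l, line_mem (iid p) l /\ line_mem (iid q) l.
  split=> [/and4P[ep eq pq sh]|[pq [l [/line_memP[ep lp] /line_memP[eq lq]]]]].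
    split; first exact/eqP.
    have [l [lp lq]] : exists l, (l = iid p.1 \/ l = iid p.2) /\ (l = iid q.1 \/ l = iid q.2).
      by case/or4P: sh => /eqP E; [exists (iid p.1)|exists (iid p.1)|exists (iid p.2)|exists (iid p.2)]; rewrite E; auto.
    by exists l; split; apply/line_memP.
  rewrite /= /line_adj ep eq /=; apply/andP; split; first exact/eqP.
  apply/or4P; move: lp lq => [] -> [] /inj ->; rewrite eqxx;
    by [constructor 1|constructor 2|constructor 3|constructor 4].
have few (p : ivert (line_instance I)) :
    exists2 s : seq nat, size s <= 2 & forall l, line_mem (iid p) l -> l \in s.
  exists [:: iid p.1; iid p.2] => // l /line_memP[_ [->|->]]; by rewrite !inE eqxx ?orbT.
have size l : #|[set p : ivert (line_instance I) | line_mem (iid p) l]| <= Delta.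
  have [->|/set0Pn[p0]] := eqVneq [set p : ivert (line_instance I) | line_mem (iid p) l] set0.
    by rewrite cards0.
  rewrite inE => /line_memP[_ hz].
  have [z lz] : exists z : ivert I, l = iid z.
    by case: hz => ->; [exists p0.1|exists p0.2].
  apply: (@leq_trans #|[set w | iadj I z w]|); last first.
    by rewrite -degE; exact: (@leq_bigmax _ (fun v => #|[set w | iadj I v w]|)).
  (* Edges at [z] are counted by their other end; this is injective because an edge is oriented by
     its identifiers and occurs as one pair only. *)
  pose other (p : ivert I * ivert I) := if p.1 == z then p.2 else p.1.
  have ends (p : ivert I * ivert I) : line_mem (line_id p) l -> edge_pair p /\ (p.1 = z \/ p.2 = z).
    by move=> /line_memP[ep]; rewrite lz => -[/inj->|/inj->]; auto.
  have -> : #|[set p : ivert (line_instance I) | line_mem (iid p) l]| =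
     #|other @: [set p : ivert I * ivert I | line_mem (line_id p) l]|.
    rewrite card_in_imset // => p q; rewrite !inE => /ends[ep hp] /ends[eq hq].
    rewrite /other; move: ep eq hp hq; rewrite /edge_pair.
    case: p q => [p1 p2] [q1 q2] /= /andP[_ lp] /andP[_ lq].
    case: eqP => [p1z|np]; case: eqP => [q1z|nq] hp hq E.
    - by rewrite p1z q1z E.
    - case: hq => // q2z; move: lp lq; rewrite p1z q2z E => lt /(ltn_trans lt).
      by rewrite ltnn.
    - case: hp => // p2z; move: lp lq; rewrite q1z p2z E => lt /(ltn_trans lt).
      by rewrite ltnn.
    by case: hp => // ->; case: hq => // ->; rewrite E.
  apply: subset_leq_card; apply/subsetP => w /imsetP[p]; rewrite !inE => /ends[/andP[p12 _] hp] ->.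
  rewrite /other; case: eqP hp => [<- //|np [//|<-]].
  by rewrite sym.
have [||h1 h2] := hA (line_instance I) sym' inj' _ cl _ few size.
- move=> p; rewrite /L (_ : 2 * L0 + 4 = L0 + L0 + 4); last by lia.
  rewrite !expnD; have := ids_bound_log c n; rewrite -/L0; set N := 2 ^ L0 => hN.
  have b1 : iid p.1 < N by apply: leq_trans hN; rewrite -cn.
  have b2 : iid p.2 < N by apply: leq_trans hN; rewrite -cn.
  rewrite /= /line_id /pair_code expnS expn1.
  have : (iid p.1 + iid p.2).+2 * (iid p.1 + iid p.2).+2 <= (N + N) * (N + N) by apply: leq_mul; lia.
  by rewrite (_ : 2 ^ 4 = 16) //; case: edge_pair => /=; nia.
- move=> p; have [s ss hs] := few p.
  apply: (@leq_trans (seq.size s * Delta)); last by rewrite leq_mul2r ss orbT.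
  apply: leq_trans _ (card_has_le s size); apply: subset_leq_card.
  apply/subsetP => q; rewrite !inE => /cl[_ [l [lp lq]]].
  by apply/hasP; exists l; [exact: hs|rewrite inE].
have orientC (u w : ivert I) : u <> w -> orient u w = orient w u.
  by move=> uw; rewrite /orient; case: (ltngtP (iid u) (iid w)) => // /inj ->.
have neq (u w : ivert I) : iadj I u w -> u <> w by move=> uw E; rewrite E irr in uw.
split=> [u w uw|v u w vu vw uw].
  have wu : iadj I w u by rewrite sym.
  by rewrite !edge_outputE // -orientC //; apply: neq.
rewrite !edge_outputE //; apply: h1.
have ed (y z : ivert I) : iadj I y z -> edge_pair (orient y z).
  move=> yz; rewrite /edge_pair /orient; case: ifP => lt; rewrite /= ?yz ?lt // sym yz /=.
  by rewrite ltn_neqAle leqNgt lt andbT; apply/eqP => /inj E; apply: (neq _ _ yz).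
rewrite /= /line_adj !ed //=; apply/andP; split.
  apply/eqP; rewrite /orient; case: ifP => _; case: ifP => _ [] //.
  - by move=> E1 E2; apply: (neq _ _ vw).
  - by move=> E1 E2; apply: (neq _ _ vu).
apply/or4P; rewrite /orient; case: ifP => _; case: ifP => _ /=; rewrite eqxx;
  by [constructor 1|constructor 2|constructor 3|constructor 4].
Qed.

(** * Real bounds *)

Section RealBounds.
Local Open Scope R_scope.

Lemma INR_addn m n : INR (m + n) = INR m + INR n.
Proof. exact: plus_INR. Qed.

Lemma INR_muln m n : INR (m * n) = INR m * INR n.
Proof. exact: mult_INR. Qed.

Lemma INR_expn m n : INR (m ^ n)%N = INR m ^ n.
Proof. by elim: n => [|n IH] /=; rewrite ?expn0 // expnS INR_muln IH. Qed.

Lemma INR_leq m n : (m <= n)%N -> INR m <= INR n.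
Proof. by move=> /leP; apply: le_INR. Qed.

Lemma INR_ge1 n : (0 < n)%N -> 1 <= INR n.
Proof. exact: (@INR_leq 1). Qed.

Lemma ln_mono a b : 0 < a -> a <= b -> ln a <= ln b.
Proof.
by move=> a0 [lt|->]; [apply: Rlt_le; apply: ln_increasing|apply: Rle_refl].
Qed.

Lemma trunc_log_ln m : (0 < m)%N -> INR (trunc_log 2 m) <= 2 * ln (INR m).
Proof.
move=> m0; have := INR_leq (trunc_logP (isT : 1 < 2)%N m0); rewrite INR_expn => h.
have h2 : INR 2 = 2 by [].
have p : 0 < 2 ^ trunc_log 2 m by apply: pow_lt; lra.
rewrite h2 in h; have := ln_mono p h; rewrite ln_pow; last lra.
have := ln_lt_2; have := pos_INR (trunc_log 2 m); nra.
Qed.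

Lemma Rpower_ge1 a y : 1 <= a -> 0 <= y -> 1 <= Rpower a y.
Proof.
move=> a1 y0; rewrite -(Rpower_O a); last lra.
by apply: Rle_Rpower.
Qed.

(** [t] is the least integer with [S <= t ^ x.+1]. By minimality [t - 1] is at most the real root,
    and the root is at least [1], hence the factor [2]. *)
Lemma root_ceil S x : (0 < S)%N -> exists t, [/\ (0 < t)%N, (S <= t ^ x.+1)%N &
  INR t <= 2 * Rpower (INR S) (1 / (INR x + 1))].
Proof.
move=> S0; have ex : exists t, (S <= t ^ x.+1)%N.
  by exists S; rewrite expnS leq_pmulr // expn_gt0 S0.
have x1 : 0 < INR x + 1 by have := pos_INR x; lra.
have y0 : 0 <= 1 / (INR x + 1) by apply: Rlt_le; apply: Rdiv_lt_0_compat; lra.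
have S1 := INR_ge1 S0; have Q1 := Rpower_ge1 S1 y0.
case: (ex_minnP ex) => t St min; exists t; split=> //.
  by case: t St {min} => //; rewrite exp0n // leqNgt S0.
case: t St min => [|[|t]] St min; first by rewrite /=; lra.
  by rewrite /=; lra.
have lt : (t.+1 ^ x.+1 <= S)%N.
  by apply: ltnW; rewrite ltnNge; apply/negP => /min; rewrite ltnn.
have t1 : 0 < INR t.+1 by apply: lt_0_INR; apply/ltP.
have := INR_leq lt; rewrite INR_expn => h.
have p : 0 < INR t.+1 ^ x.+1 by apply: pow_lt.
have := ln_mono p h; rewrite ln_pow // S_INR => hl.
suff : INR t.+1 <= Rpower (INR S) (1 / (INR x + 1)).
  by rewrite (S_INR t.+1); have := INR_ge1 (ltn0Sn t); lra.
rewrite /Rpower -{1}(exp_ln _ t1).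
suff le : ln (INR t.+1) <= 1 / (INR x + 1) * ln (INR S).
  by case: le => [lt'|->]; [apply: Rlt_le; apply: exp_increasing|apply: Rle_refl].
apply: (Rmult_le_reg_l (INR x + 1)) => //.
rewrite /Rdiv Rmult_1_l -Rmult_assoc Rinv_r; lra.
Qed.

(** The power of two is twice [2 ^ h], where [2 ^ h] is at most the square root of [d.+1], hence at
    most [4 * Q]. The exponent [3] of [P] comes from one logarithm for the phases and two for
    [k ^ 2]. *)
Lemma base_rounds_bound (A P Q : R) (k d : nat) :
  0 <= A -> 1 <= P -> 1 <= Q -> INR k <= A * P ->
  INR (trunc_log 2 d.+1).+1 <= 2 * P -> INR d.+1 <= 16 * Q ^ 2 ->
  INR (base_rounds k d) <= 384 * A ^ 2 * (P ^ 3 * Q).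
Proof.
move=> A0 P1 Q1 kP lP dQ; rewrite /base_rounds !INR_muln !INR_expn.
set l := trunc_log 2 d.+1 in lP *; set h := l./2.
have h2 : INR 2 = 2 by [].
have hQ : 2 ^ h <= 4 * Q.
  have le : (2 ^ h * 2 ^ h <= d.+1)%N.
    rewrite -expnD addnn; apply: leq_trans (trunc_logP (isT : 1 < 2)%N (ltn0Sn d)).
    by rewrite leq_exp2l // -[leqRHS]odd_double_half leq_addl.
  have := INR_leq le; rewrite INR_muln !INR_expn h2 => le2.
  have p : 0 < 2 ^ h by apply: pow_lt; lra.
  case: (Rle_lt_dec (2 ^ h) (4 * Q)) => // lt; exfalso.
  have : 4 * Q * (4 * Q) < 2 ^ h * 2 ^ h by apply: Rmult_le_0_lt_compat; lra.
  nra.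
have k2 : INR k ^ 2 <= A ^ 2 * P ^ 2.
  by rewrite -Rpow_mult_distr; apply: pow_incr; split=> //; apply: pos_INR.
have -> : INR 24 = 24 by rewrite /=; lra.
rewrite h2 -(tech_pow_Rmult 2 h).
have p1 := pos_INR l.+1; have p2 : 0 <= INR k ^ 2 by apply: pow2_ge_0.
have p3 : 0 <= 2 ^ h by apply: Rlt_le; apply: pow_lt; lra.
have s1 : 24 * INR k ^ 2 * (2 * 2 ^ h) <= 24 * (A ^ 2 * P ^ 2) * (2 * (4 * Q)).
  by apply: Rmult_le_compat; lra.
have p4 : 0 <= 24 * INR k ^ 2 * (2 * 2 ^ h).
  by apply: Rmult_le_pos; lra.
have s2 := Rmult_le_compat _ _ _ _ p1 p4 lP s1.
have -> : INR k * INR k = INR k ^ 2 by ring.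
apply: (Rle_trans _ _ _ s2); apply: Req_le; ring.
Qed.

(** [770] is [2 * 385]: one more round per stage raises [384] to [385], and [x + 1 <= 2 * x]. *)
Lemma total_rounds_bound (A P Q : R) (k d x r0 n : nat) :
  1 <= A -> 1 <= P -> 1 <= Q -> INR k <= A * P ->
  INR (trunc_log 2 d.+1).+1 <= 2 * P -> INR d.+1 <= 16 * Q ^ 2 ->
  (0 < x)%N -> INR r0 <= A ->
  INR (r0 + logstar n + x.+1 * (base_rounds k d).+1) <=
  770 * A ^ 2 * (INR x * Q * P ^ 3 + INR (logstar n)) + 770 * A ^ 2.
Proof.
move=> A1 P1 Q1 kP lP dQ x0 r0A.
have b : INR (base_rounds k d) <= 384 * A ^ 2 * (P ^ 3 * Q) by apply: base_rounds_bound => //; lra.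
rewrite !INR_addn INR_muln (S_INR (base_rounds _ _)) (S_INR x).
have x1 := INR_ge1 x0; have l0 := pos_INR (logstar n).
have A2 : 1 <= A ^ 2 by apply: pow_R1_Rle.
have AA : A <= A ^ 2 by rewrite /= Rmult_1_r; nra.
have P3 : 1 <= P ^ 3 by apply: pow_R1_Rle.
have PQ : 1 <= P ^ 3 * Q by nra.
have b1 : INR (base_rounds k d) + 1 <= 385 * A ^ 2 * (P ^ 3 * Q) by nra.
have b0 := pos_INR (base_rounds k d).
have s1 : (INR x + 1) * (INR (base_rounds k d) + 1) <= 2 * INR x * (385 * A ^ 2 * (P ^ 3 * Q)).
  by apply: Rmult_le_compat; lra.
have -> : 770 * A ^ 2 * (INR x * Q * P ^ 3 + INR (logstar n)) + 770 * A ^ 2 =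
  2 * INR x * (385 * A ^ 2 * (P ^ 3 * Q)) + 770 * (A ^ 2 * INR (logstar n)) + 770 * A ^ 2 by ring.
have : INR (logstar n) <= A ^ 2 * INR (logstar n) by nra.
nra.
Qed.

Lemma ln_INR_ge0 m : 0 <= ln (INR m + 1).
Proof.
rewrite -ln_1; apply: ln_mono; first lra.
by have := pos_INR m; lra.
Qed.

End RealBounds.

Section FinalBounds.
Local Open Scope R_scope.
Variables (c Delta : nat).
(** The factor [4] over [2 ^ (c + 10)] pays for passing from binary to natural logarithms and for
    the additive constants in the bit length [k]. *)
Let A : R := INR (2 ^ (c + 12))%N.
Let P : R := ln (INR Delta + 1) + 1.

Lemma pow_const : A = 4 * INR (2 ^ (c + 10))%N /\ 1 <= INR (2 ^ (c + 10))%N.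
Proof.
split; last by apply: INR_ge1; rewrite expn_gt0.
rewrite /A (_ : c + 12 = 2 + (c + 10))%N; last by lia.
by rewrite expnD INR_muln /=; lra.
Qed.

Lemma polylog_base_ge1 : 1 <= P.
Proof. by have := ln_INR_ge0 Delta; rewrite /P; lra. Qed.

Lemma trunc_log_polylog m : (m <= Delta.+1)%N -> INR (trunc_log 2 m) <= 2 * (P - 1).
Proof.
move=> le; apply: (Rle_trans _ _ _ (INR_leq (leq_trunc_log 2 le))).
apply: (Rle_trans _ _ _ (trunc_log_ln (ltn0Sn Delta))).
by rewrite S_INR /P; lra.
Qed.

Lemma trunc_log_polylog2 m : (m <= 2 * Delta.+1)%N ->
  INR (trunc_log 2 m) <= 2 * (P - 1) + 1.
Proof.
move=> le; apply: (Rle_trans _ _ _ (INR_leq (leq_trunc_log 2 le))).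
rewrite trunc_logMp // S_INR.
by have := trunc_log_polylog (leqnn Delta.+1); lra.
Qed.

Lemma vertex_rounds_le (C x n D S t : nat) :
  770 * A ^ 2 <= INR C -> (0 < x)%N -> (2 <= D)%N -> (0 < S)%N -> (0 < t)%N ->
  INR t <= 2 * Rpower (INR S) (1 / (INR x + 1)) ->
  INR (1 + logstar n + x.+1 *
       (base_rounds (2 ^ (c + 10) * (trunc_log 2 Delta + 2)).+1
          (minn Delta (D * (2 * t)))).+1)
  <= vertex_round_bound C 3 x n Delta D S.
Proof.
move=> hC x0 D2 S0 t0 ht; have [Ak k1] := pow_const; have P1 := polylog_base_ge1.
have xp : 0 < INR x + 1 by have := pos_INR x; lra.
have y0 : 0 <= 1 / (INR x + 1) by apply: Rlt_le; apply: Rdiv_lt_0_compat; lra.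
have rp := Rpower_ge1 (INR_ge1 S0) y0.
set rho := Rpower _ _ in ht rp *.
have hD : 1 <= INR D by apply: INR_ge1; apply: leq_trans D2.
set Q := sqrt (INR D * rho).
have Dr : 1 <= INR D * rho by nra.
have QQ : Q ^ 2 = INR D * rho by apply: pow2_sqrt; lra.
have Q1 : 1 <= Q by rewrite -sqrt_1; apply: sqrt_le_1_alt.
have hb := @total_rounds_bound A P Q
  (2 ^ (c + 10) * (trunc_log 2 Delta + 2)).+1 (minn Delta (D * (2 * t))) x 1 n.
apply: Rle_trans (hb _ P1 Q1 _ _ _ x0 _) _; try lra.
- rewrite S_INR INR_muln INR_addn; have -> : INR 2 = 2 by [].
  have := trunc_log_polylog (leqnSn Delta); rewrite Ak; nra.
- rewrite S_INR; have le : ((minn Delta (D * (2 * t))).+1 <= Delta.+1)%N by rewrite ltnS geq_minl.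
  by have := trunc_log_polylog le; lra.
- have : ((minn Delta (D * (2 * t))).+1 <= (D * (2 * t)).+1)%N by rewrite ltnS geq_minr.
  move=> /INR_leq le; apply: (Rle_trans _ _ _ le).
  rewrite S_INR !INR_muln QQ; have -> : INR 2 = 2 by [].
  have t1 := INR_ge1 t0; have : INR D * INR t <= INR D * (2 * rho) by nra.
  nra.
- by rewrite /=; lra.
rewrite /vertex_round_bound /polylog -/P -/rho -/Q.
have pos : 0 <= INR x * Q * P ^ 3 + INR (logstar n).
  have := pos_INR (logstar n); have := pos_INR x; have := pow_R1_Rle P 3 P1.
  move=> h1 h2 h3; have : 0 <= INR x * Q by nra.
  by nra.
by apply: Rplus_le_compat => //; apply: Rmult_le_compat_r.
Qed.

Lemma edge_rounds_le (C x n t : nat) :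
  770 * A ^ 2 <= INR C -> (0 < x)%N -> (0 < Delta)%N -> (0 < t)%N ->
  INR t <= 2 * Rpower (INR Delta) (1 / (INR x + 1)) ->
  INR (logstar n + x.+1 *
       (base_rounds (2 ^ (c + 10) * (trunc_log 2 (2 * Delta) + 2)).+1
          (minn (2 * Delta) (2 * (2 * t)))).+1).+2
  <= edge_round_bound C 3 x n Delta.
Proof.
move=> hC x0 D0 t0 ht; have [Ak k1] := pow_const; have P1 := polylog_base_ge1.
have xp : 0 < INR x + 1 by have := pos_INR x; lra.
have y0 : 0 <= 1 / (2 * INR x + 2) by apply: Rlt_le; apply: Rdiv_lt_0_compat; lra.
have Q1 := Rpower_ge1 (INR_ge1 D0) y0.
set Q := Rpower _ _ in Q1.
(* The exponent [1 / (2x + 2)] is half of [1 / (x + 1)], so [Q ^ 2] is the root that bounds [t], and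
   thereby the degree. *)
have QQ : Rpower (INR Delta) (1 / (INR x + 1)) = Q ^ 2.
  rewrite /= Rmult_1_r /Q -Rpower_plus; congr Rpower; field; lra.
rewrite QQ in ht.
have hb := @total_rounds_bound A P Q
  (2 ^ (c + 10) * (trunc_log 2 (2 * Delta) + 2)).+1 (minn (2 * Delta) (2 * (2 * t))) x 2 n.
rewrite -addn2 addnC addnA.
apply: Rle_trans (hb _ P1 Q1 _ _ _ x0 _) _; try lra.
- rewrite S_INR INR_muln INR_addn; have -> : INR 2 = 2 by [].
  have le : (2 * Delta <= 2 * Delta.+1)%N by rewrite leq_mul2l leqnSn orbT.
  by have := trunc_log_polylog2 le; rewrite Ak; nra.
- rewrite S_INR; have le : ((minn (2 * Delta) (2 * (2 * t))).+1 <= 2 * Delta.+1)%N.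
    by apply: (@leq_trans (2 * Delta).+1); [rewrite ltnS geq_minl|lia].
  by have := trunc_log_polylog2 le; lra.
- have : ((minn (2 * Delta) (2 * (2 * t))).+1 <= (2 * (2 * t)).+1)%N by rewrite ltnS geq_minr.
  move=> /INR_leq le; apply: (Rle_trans _ _ _ le).
  rewrite S_INR !INR_muln; have -> : INR 2 = 2 by [].
  have t1 := INR_ge1 t0; nra.
- by rewrite (_ : INR 2 = 2) //; lra.
rewrite /edge_round_bound /polylog -/P -/Q.
have pos : 0 <= INR x * Q * P ^ 3 + INR (logstar n).
  have := pos_INR (logstar n); have := pos_INR x; have := pow_R1_Rle P 3 P1.
  move=> h1 h2 h3; have : 0 <= INR x * Q by nra.
  by nra.
by apply: Rplus_le_compat => //; apply: Rmult_le_compat_r.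
Qed.

Lemma rounds_constant : exists C, 770 * A ^ 2 <= INR C.
Proof. by have [C hC] := INR_unbounded (770 * A ^ 2); exists C; apply: Rlt_le. Qed.

Lemma round_bound_ge0 (C x n : nat) (q : R) : 0 <= q ->
  0 <= INR C * (INR x * q * polylog 3 Delta + INR (logstar n)) + INR C.
Proof.
move=> q0; have p0 : 0 <= polylog 3 Delta.
  by apply: pow_le; have := polylog_base_ge1; rewrite /P; lra.
have := pos_INR (logstar n); have := pos_INR x; have := pos_INR C => h1 h2 h3.
apply: Rplus_le_le_0_compat => //; apply: Rmult_le_pos => //.
by apply: Rplus_le_le_0_compat => //; apply: Rmult_le_pos => //; apply: Rmult_le_pos.
Qed.
End FinalBounds.

(** * Assembling the two algorithms *)

Lemma max_diversity_clique_gt0 (I : instance) :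
  0 < max_diversity I -> 0 < max_clique_size I.
Proof.
rewrite lt0n => h.
have [v _|no] := pickP (fun v : ivert I => true); last first.
  by move: h; rewrite /max_diversity big_pred0.
have cv : clique [set v].
  by apply/cliqueP => u w; rewrite !inE => /eqP-> /eqP->; rewrite eqxx.
apply: (@leq_trans #|[set v]|); first by rewrite cards1.
exact: (@leq_bigmax_cond _ (fun K : {set ivert I} => clique K) (fun K => #|K|) _ cv).
Qed.

Theorem mainTheorem8 :
  forall c : nat, 1 <= c ->
  (* (i) vertex coloring with D^(x+1) S colors *)
  (forall xf : nat -> nat, (forall m, 1 <= xf m) -> little_o_log xf ->
    exists (C k : nat) (A : nat -> nat -> nat -> nat -> algorithm nat),
      forall n Delta D S : nat,
        (exists r : nat, local_alg (A n Delta D S) r /\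
           Rle (INR r) (vertex_round_bound C k (xf S) n Delta D S)) /\
        (forall I : instance, valid I -> #|ivert I| = n -> ids_bounded c I ->
           max_degree I = Delta -> max_diversity I = D -> 2 <= D ->
           max_clique_size I = S ->
           proper_vertex_coloring (A n Delta D S I) (D ^ (xf S).+1 * S)))
  /\
  (* (ii) edge coloring with 2^(x+1) Delta colors *)
  (forall xf : nat -> nat, (forall m, 1 <= xf m) -> little_o_log xf ->
    exists (C k : nat) (A : nat -> nat -> algorithm (nat -> nat)),
      forall n Delta : nat,
        (exists r : nat, local_alg (A n Delta) r /\
           Rle (INR r) (edge_round_bound C k (xf Delta) n Delta)) /\
        (forall I : instance, valid I -> #|ivert I| = n -> ids_bounded c I ->
           max_degree I = Delta ->
           proper_edge_coloring (A n Delta I) (2 ^ (xf Delta).+1 * Delta))).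
Proof.
move=> c _; have [C hC] := rounds_constant c.
split=> xf xf1 _; exists C, 3.
  (* The parameters are global knowledge, so an algorithm may be chosen separately for each tuple of
     them. *)
  suff /choice [A hA] : forall p : nat * nat * nat * nat, exists A : algorithm nat,
      (exists r : nat, local_alg A r /\
         Rle (INR r) (vertex_round_bound C 3 (xf p.2) p.1.1.1 p.1.1.2 p.1.2 p.2)) /\
      (forall I : instance, valid I -> #|ivert I| = p.1.1.1 -> ids_bounded c I ->
         max_degree I = p.1.1.2 -> max_diversity I = p.1.2 -> 2 <= p.1.2 ->
         max_clique_size I = p.2 ->
         proper_vertex_coloring (A I) (p.1.2 ^ (xf p.2).+1 * p.2)).
    by exists (fun n Delta D S => A (n, Delta, D, S)) => n Delta D S; apply: (hA (n, Delta, D, S)).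
  move=> [[[n Delta] D] S] /=.
  (* In the other case correctness is vacuous, since [2 <= D] yields a vertex and so a positive [S];
     a constant algorithm with [0] rounds serves. *)
  have [/andP[D2 S0]|triv] := boolP ((2 <= D) && (0 < S)); last first.
    exists (fun _ _ => 0); split; last first.
      move=> I _ _ _ _ dI D2 sI; move: triv; rewrite D2 -sI max_diversity_clique_gt0 //.
      by rewrite dI; apply: ltnW.
    exists 0; split=> //; apply: round_bound_ge0; exact: sqrt_pos.
  have [t [t0 St ht]] := root_ceil (xf S) S0.
  have [A locA hA] := vertex_coloring_alg c n Delta D2 S0 t0 St.
  exists A; split; last by move=> I V nI idI dI DI _ SI; apply: hA.
  by eexists; split; [exact: locA|apply: vertex_rounds_le].
suff /choice [A hA] : forall p : nat * nat, exists A : algorithm (nat -> nat),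
    (exists r : nat, local_alg A r /\
       Rle (INR r) (edge_round_bound C 3 (xf p.2) p.1 p.2)) /\
    (forall I : instance, valid I -> #|ivert I| = p.1 -> ids_bounded c I ->
       max_degree I = p.2 -> proper_edge_coloring (A I) (2 ^ (xf p.2).+1 * p.2)).
  by exists (fun n Delta => A (n, Delta)) => n Delta; apply: (hA (n, Delta)).
(* For [Delta = 0] there are no edges, and a constant output with [0] rounds is proper. *)
move=> [n Delta] /=; have [D0|] := ltnP 0 Delta; last first.
  rewrite leqn0 => /eqP->; exists (fun _ _ _ => 0); split.
    by exists 0; split=> //; apply: round_bound_ge0; apply: Rlt_le; apply: exp_pos.
  move=> I _ _ _ d0; have no u w : ~~ iadj I u w.
    apply/negP => uw; have := @leq_bigmax _ (fun v => #|[set w | iadj I v w]|) u.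
    by rewrite -/(max_degree I) d0 leqn0 cards_eq0 => /eqP/setP/(_ w); rewrite !inE uw.
  by split=> [u w uw|v u w vu]; [have := no u w; rewrite uw|have := no v u; rewrite vu].
have [t [t0 Dt ht]] := root_ceil (xf Delta) D0.
have [A locA hA] := edge_coloring_alg c n D0 t0 Dt.
exists A; split; last exact: hA.
by eexists; split; [exact: locA|apply: edge_rounds_le].
Qed.
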